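(* Let $\mathcal P\subset\mathbb R^d$ ($d\ge2$) be a finite union of grids with a fixed admissible presentation, with commensurability classes $\Psi_1,\dots,\Psi_N$ and corresponding subconfigurations $\mathcal P_j=\bigcup_{\psi\in\Psi_j}\mathcal L_\psi$. Then the limiting free path length densities satisfy, for all $\xi>0$, $$\Phi_{\mathcal P}(\xi)=-\frac{d}{d\xi}\prod_{j=1}^N\int_\xi^\infty\Phi_{\mathcal P_j}(\xi')\,d\xi'.$$
   Context: Vectors in $\mathbb R^d$ are row vectors; vectors in $\mathbb R^{r_j}$ are column vectors. A grid is a translate of a full-rank lattice. $B_1^{d-1}$ is the open unit ball in $\mathbb R^{d-1}$, $v_{d-1}=\mathrm{vol}(B_1^{d-1})$. Presentation: integers $N,r_1,\dots,r_N\ge1$, $\Psi=\{(j,i):1\le j\le N,1\le i\le r_j\}$ ($j_\psi=j$ for $\psi=(j,i)$), $M_1,\dots,M_N\in\mathrm{SL}_d(\mathbb R)$, $c_\psi>0$, $w_\psi\in\mathbb R^d$, with $\mathcal P=\bigcup_\psi\mathcal L_\psi$, $\mathcal L_\psi=c_\psi(\mathbb Z^d+w_\psi)M_{j_\psi}$, such that (a) if $\psi\ne\psi'$, $j_\psi=j_{\psi'}$, $c_\psi/c_{\psi'}\in\mathbb Q$ then $\mathcal L_\psi\cap\mathcal L_{\psi'}=\emptyset$; (b) $M_jM_{j'}^{-1}\notin\{(\det T)^{-1/d}T:T\in\mathrm{GL}_d(\mathbb Q),\det T>0\}$ for $j\ne j'$. The commensurability classes are $\Psi_j=\{(j,i):1\le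 i\le r_j\}$. For nonempty $S\subset\mathbb R^r$, $\mathfrak L(S)$ is the identity component of the closure of the subgroup generated by $S\cup\mathbb Z^r$ (a linear subspace). $\tilde c_j=(c_{j,1}^{-1},\dots,c_{j,r_j}^{-1})^{\mathsf T}$, $c_j^\psi=c_\psi\tilde c_j$; $W_j$ is the $r_j\times d$ matrix with rows $w_{j,i}$; $W_j^\psi=W_j-c_j^\psi w_\psi M_{j_\psi}M_j^{-1}$. For $\psi=(j,i)$, $L_j^\psi=\mathfrak L(\{c_j^\psi\}\cup\{\text{columns of }W_j^\psi\})$. The presentation is admissible if $c_j^\psi\in L_j^\psi+\mathbb Z^{r_j}$ for all $\psi=(j,i)\in\Psi$. Also $L_j=\mathfrak L(\mathbb R\tilde c_j\cup\{\text{columns of }W_j\})$. $\mathbb T_j^d=\mathrm M_{r_j\times d}(\mathbb R/\mathbb Z)=((\mathbb R/\mathbb Z)^{r_j})^d$ (columns), with right action of $\mathrm{SL}_d(\mathbb Z)$; $\pi$ is reduction mod $\mathbb Z$. For any $q\in\mathbb R^d$ let $U_j^{(q)}$ be the $r_j\times d$ matrix with rows $w_{j,i}-c_{j,i}^{-1}qM_j^{-1}$. The set $\bigcup_{\gamma\in\mathrm{SL}_d(\mathbb Z)}(\pi(U_j^{(q)})\gamma+\pi(L_j)^d)$ is a finite union of cosets of the subtorus $\pi(L_j)^d$, independent of $q$; $\omega_j^{\mathsf g}$ is the probability measure giving equal mass to each coset and proportional to translated Haar measure on each. Let $Y^{\mathsf g}=\bigcup_{(j,i)\in\Psi}c_{j,i}((\mathbb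 Z^d+u_{j,i})A_j)\times\{(j,i)\}\subset\mathbb R^d\times\Psi$, where $A_1,\dots,A_N,U_1,\dots,U_N$ are independent, $A_j$ is distributed by Haar probability measure on a Borel fundamental domain for $\mathrm{SL}_d(\mathbb Z)\backslash\mathrm{SL}_d(\mathbb R)$, $U_j\in\mathbb T_j^d$ is distributed by $\omega_j^{\mathsf g}$, and $u_{j,i}\in(\mathbb R/\mathbb Z)^d$ is the $i$th row of $U_j$ ($\mathbb Z^d+u$ is the inverse image of $u$ in $\mathbb R^d$). Let $z(Y)$ be the point of $Y\cap((0,\infty)\times B_1^{d-1}\times\Psi)$ with minimal first coordinate and $\iota((\xi,w),\psi)=((\xi,-w),\psi)$. With $\bar n_\psi=c_\psi^{-d}$, $\bar n_{\mathcal P}=\sum_\psi\bar n_\psi$, $\mathsf m(\psi)=\bar n_\psi/\bar n_{\mathcal P}$, the transition kernel $k^{\mathsf g}(\xi,w,\psi)$ is the continuous version of the density of the law of $\iota(z(Y^{\mathsf g}))$ with respect to $v_{d-1}^{-1}d\xi\,dw\,d\mathsf m(\psi)$ on $\mathbb R_{>0}\times B_1^{d-1}\times\Psi$. The free path length density (for a generic starting point, in the Boltzmann–Grad limit) is $$\Phi_{\mathcal P}(\xi)=\frac1{v_{d-1}}\int_{B_1^{d-1}\times\Psi}k^{\mathsf g}(\xi,w,\psi)\,dw\,d\mathsf m(\psi).$$ $\Phi_{\mathcal P_j}$ is defined by the same construction applied to $\mathcal P_j$ with the (admissible) presentation given by the single matrix $M_j$ and the data $c_{j,i},w_{j,i}$,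 $1\le i\le r_j$. *)

(* Defs.v *)
From HB Require Import structures.
From mathcomp Require Import all_boot all_order all_algebra.
From mathcomp Require Import generic_quotient ring_quotient.
From mathcomp Require Import all_classical all_reals all_analysis.
Import Order.TTheory GRing.Theory Num.Theory numFieldNormedType.Exports.
Set Implicit Arguments.
Unset Strict Implicit.
Unset Printing Implicit Defensive.
Local Open Scope classical_set_scope.
Local Open Scope ring_scope.

(* Borel sigma-algebra of a topological space [T], on an alias of [T]. *)
Notation borel T := (g_sigma_algebraType (@open T)).

Section LebesgueRowVectors.
Variable R : realType.

(* (xi, w) |-> (xi, w) seen as a row vector of length [n.+1]. *)
Definition rVcons n (p : measurableTypeR R * borel 'rV[R]_n) :
  borel 'rV[R]_n.+1 := row_mx (p.1)%:M p.2.

Lemma measurable_rVcons n : measurable_fun setT (@rVcons n).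
Proof.
apply: (@measurability _ _ _ _ setT (@rVcons n) (@open 'rV[R]_n.+1)).
  by [].
move=> _ [U oU <-]; rewrite setTI.
pose V (q : rat * rat) := ([set w : 'rV[R]_n | forall x : R,
  ratr q.1 < x < ratr q.2 -> U (row_mx x%:M w : 'rV[R]_(1 + n))])°.
have -> : rVcons (n := n) @^-1` U =
  \bigcup_(q in [set: rat * rat]) (`](ratr q.1 : R), ratr q.2[%classic `*` V q).
  apply/seteqP; split => [[x w] /= Uxw|[x w] [q _ [/= xq /interior_subset]]].
    have /nbhs_ballP[e /= e0 eU] := open_nbhs_nbhs (conj oU Uxw).
    have [a xa] : exists a, (ratr a : R) \in `]x - e, x[.
      by apply: rat_in_itvoo; rewrite ltrBlDr ltrDl.
    have [b xb] : exists a, (ratr a : R) \in `]x, x + e[.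
      by apply: rat_in_itvoo; rewrite ltrDl.
    exists (a, b) => //; split => /=.
      by rewrite in_itv/= (itvP xa) (itvP xb).
    apply/nbhs_ballP; exists e => //= w' [_ ww'] x' /andP[ax' x'b].
    apply: eU; split => // i j; rewrite !mxE.
    case: splitP => k _; last exact: ww'.
    rewrite !ord1 !mxE eqxx !mulr1n /ball/= ltr_distlC.
    rewrite (lt_trans _ ax') ?(itvP xa)//= (lt_trans x'b) ?(itvP xb)//.
  by apply; move: xq; rewrite in_itv.
apply: countable_bigcupT_measurable => // q; apply: measurableX.
  exact: measurable_itv.
by apply: sub_sigma_algebra; exact: open_interior.
Qed.

Definition rVuncons n (x : borel 'rV[R]_n.+1) :
  measurableTypeR R * borel 'rV[R]_n :=
  (x ord0 ord0, rsubmx (x : 'rV[R]_(1 + n))).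

Lemma rVconsK n : cancel (@rVcons n) (@rVuncons n).
Proof.
move=> [x w]; rewrite /rVuncons/rVcons; congr pair; last exact: row_mxKr.
rewrite mxE; case: splitP => // j _.
by rewrite !ord1 mxE eqxx mulr1n.
Qed.

Lemma measurable_rVuncons n : measurable_fun setT (@rVuncons n).
Proof.
apply/measurable_fun_pairP; split.
  apply: (measurability _ (measurable_realfun.RGenOpens.measurableE R)).
  move=> _ [_ [a [b ->]] <-]; rewrite setTI; apply: sub_sigma_algebra.
  have := @interval_open R (BRight a) (BLeft b) isT isT.
  apply: (@open_comp _ _ (fun x : 'rV[R]_n.+1 => x ord0 ord0)) => x _.
  exact: coord_continuous.
apply: (@measurability _ _ (borel 'rV[R]_n.+1) (borel 'rV[R]_n) setT
  (snd \o @rVuncons n) (@open 'rV[R]_n)) => //.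
move=> _ [U oU <-]; rewrite setTI; apply: sub_sigma_algebra.
move: oU; apply: (@open_comp _ _ (fun x : 'rV[R]_n.+1 => rsubmx (x : 'rV_(1 + n)))).
move=> x _ A /nbhs_ballP[e /= e0 eA]; apply/nbhs_ballP; exists e => //= y [_ xy].
by apply: eA; split => // i j; rewrite !mxE; exact: xy.
Qed.

Section Step.
Variables (n : nat) (mu : {sigma_finite_measure set (borel 'rV[R]_n) -> \bar R}).

Definition lebesgue_rVS := pushforward (@lebesgue_measure R \x mu)%E (@rVcons n).

Let mcons A : measurable A -> measurable (@rVcons n @^-1` A).
Proof.
by move=> mA; rewrite -[X in measurable X]setTI; exact: measurable_rVcons.
Qed.

Let lebesgue_rVS0 : lebesgue_rVS set0 = 0%E.
Proof. by rewrite /lebesgue_rVS /pushforward preimage_set0 measure0. Qed.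

Let lebesgue_rVS_ge0 A : (0 <= lebesgue_rVS A)%E.
Proof. by rewrite /lebesgue_rVS /pushforward; apply: measure_ge0. Qed.

Let lebesgue_rVS_sigma_additive : semi_sigma_additive lebesgue_rVS.
Proof.
move=> F mF tF mUF; rewrite /lebesgue_rVS /pushforward preimage_bigcup.
apply: measure_semi_sigma_additive.
- by move=> k; apply: mcons.
- apply/trivIsetP => /= i j _ _ ij; rewrite -preimage_setI.
  by move/trivIsetP : tF => /(_ _ _ _ _ ij) ->//; rewrite preimage_set0.
- by rewrite -preimage_bigcup; exact: mcons.
Qed.

HB.instance Definition _ := isMeasure.Build _ _ _ lebesgue_rVS
  lebesgue_rVS0 lebesgue_rVS_ge0 lebesgue_rVS_sigma_additive.

Let sigma_finite_lebesgue_rVS : sigma_finite setT lebesgue_rVS.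
Proof.
have /sigma_finiteP[F [TF ndF Foo]] := sigma_finiteT (@lebesgue_measure R).
have /sigma_finiteP[G [TG ndG Goo]] := sigma_finiteT mu.
exists (fun k => @rVuncons n @^-1` (F k `*` G k)).
  apply/seteqP; split => // x _.
  have [k _ Fk] : (\bigcup_k F k) (rVuncons x).1 by rewrite -TF.
  have [l _ Gl] : (\bigcup_k G k) (rVuncons x).2 by rewrite -TG.
  exists (maxn k l) => //; split.
    by move: Fk; exact/subsetPset/ndF/leq_maxl.
  by move: Gl; exact/subsetPset/ndG/leq_maxr.
move=> k; have [mF Fk] := Foo k; have [mG Gk] := Goo k; split.
  rewrite -[X in measurable X]setTI; apply: measurable_rVuncons => //.
  exact: measurableX.
rewrite /lebesgue_rVS /pushforward -comp_preimage.
rewrite (_ : _ \o _ = id); last by apply/funext => p; exact: rVconsK.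
rewrite preimage_id product_measure1E// lte_mul_pinfty// ge0_fin_numE//.
Qed.

HB.instance Definition _ :=
  Measure_isSigmaFinite.Build _ _ _ lebesgue_rVS sigma_finite_lebesgue_rVS.

End Step.

(* Lebesgue measure on R^n, as the iterated product of the one on R. *)
Fixpoint lebesgue_rV n : {sigma_finite_measure set (borel 'rV[R]_n) -> \bar R} :=
  if n is m.+1 then lebesgue_rVS (lebesgue_rV m) else dirac (0 : borel 'rV[R]_0).

End LebesgueRowVectors.

Section Presentations.
Variable R : realType.

(* The data (M_j, (c_{j,i}, w_{j,i})_{1 <= i <= r_j}) of one commensurability
   class; all index sets are 0-based. *)
Record grid_class d := GridClass {
  rk : nat;
  gmat : 'M[R]_d;
  gscale : 'I_rk -> R;
  gshift : 'I_rk -> 'rV[R]_d }.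

Record presentation d := Presentation {
  nclasses : nat;
  cls : 'I_nclasses -> grid_class d }.

Definition sub_presentation d (pr : presentation d) (j : 'I_(nclasses pr)) :
  presentation d := @Presentation d 1 (fun=> cls j).

Definition grid d (g : grid_class d) (i : 'I_(rk g)) : set 'rV[R]_d :=
  [set gscale i *: ((map_mx intr m + gshift i) *m gmat g)
     | m in [set: 'rV[int]_d]].

Definition Psi d (pr : presentation d) := {j : 'I_(nclasses pr) & 'I_(rk (cls j))}.

Definition scale d (pr : presentation d) (psi : Psi pr) : R :=
  gscale (tagged psi).

Definition grid_union d (pr : presentation d) : set 'rV[R]_d :=
  \bigcup_(psi in [set: Psi pr]) grid (tagged psi).

(* {(det T)^{-1/d} T : T in GL_d(Q), det T > 0} *)
Definition rational_SL d : set 'M[R]_d :=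
  [set (ratr (\det T) `^ (- d%:R^-1)) *: map_mx ratr T
     | T in [set T : 'M[rat]_d | 0 < \det T]].

Definition presents d (pr : presentation d) (P : set 'rV[R]_d) : Prop :=
  [/\ [/\ (0 < nclasses pr)%N,
        forall j, (0 < rk (@cls d pr j))%N,
        forall j, \det (gmat (@cls d pr j)) = 1 &
        forall psi : Psi pr, 0 < scale psi],
      P = grid_union pr,
      forall j (i i' : 'I_(rk (@cls d pr j))), i != i' ->
        (exists q : rat, gscale i / gscale i' = ratr q) ->
        grid i `&` grid i' = set0 &
      forall j j' : 'I_(nclasses pr), j != j' ->
        ~ rational_SL (gmat (cls j) *m invmx (gmat (cls j')))].

Definition generated_subgroup (V : zmodType) (S : set V) : set V :=
  [set x | forall H : set V, H 0 -> (forall a b, H a -> H b -> H (a - b)) ->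
     S `<=` H -> H x].

Definition int_vectors r : set 'cV[R]_r :=
  [set map_mx intr z | z in [set: 'cV[int]_r]].

Definition frakL r (S : set 'cV[R]_r) : set 'cV[R]_r :=
  connected_component (closure (generated_subgroup (S `|` @int_vectors r))) 0.

Definition columns r d (W : 'M[R]_(r, d)) : set 'cV[R]_r :=
  [set col k W | k in [set: 'I_d]].

Definition ctilde d (g : grid_class d) : 'cV[R]_(rk g) :=
  \col_i (gscale i)^-1.

Definition shift_mx d (g : grid_class d) : 'M[R]_(rk g, d) :=
  \matrix_(i, k) gshift i 0 k.

(* c_j^psi, W_j^psi and L_j^psi for psi = (j, i). *)
Definition cpsi d (g : grid_class d) (i : 'I_(rk g)) : 'cV[R]_(rk g) :=
  gscale i *: ctilde g.

Definition Wpsi d (g : grid_class d) (i : 'I_(rk g)) : 'M[R]_(rk g, d) :=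
  shift_mx g - cpsi i *m (gshift i *m gmat g *m invmx (gmat g)).

Definition Lpsi d (g : grid_class d) (i : 'I_(rk g)) : set 'cV[R]_(rk g) :=
  frakL ([set cpsi i] `|` columns (Wpsi i)).

Definition admissible d (pr : presentation d) : Prop :=
  forall (psi : Psi pr), exists2 l, Lpsi (tagged psi) l &
    int_vectors (cpsi (tagged psi) - l).

Definition Lgen d (g : grid_class d) : set 'cV[R]_(rk g) :=
  frakL ([set t *: ctilde g | t in [set: R]] `|` columns (shift_mx g)).

End Presentations.

Section Torus.
Variable R : realType.

Definition integers : zmodClosed R :=
  GRing.ZmodClosed.clone R Num.int_num_subdef _.

(* R / Z, as a topological abelian group. *)
Definition circle := quotient_topology (Quotient.quot integers).
HB.instance Definition _ := GRing.Zmodule.copy circle (Quotient.quot integers).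
HB.instance Definition _ := Topological.on circle.

Definition circle_pi (x : R) : circle := \pi_(circle)%qT x.

Definition torus_pi r d (V : 'M[R]_(r, d)) : 'M[circle]_(r, d) :=
  map_mx circle_pi V.

(* Right action of an integer matrix on M_{r x d}(R/Z). *)
Definition torus_act r d (t : 'M[circle]_(r, d)) (gam : 'M[int]_d) :
  'M[circle]_(r, d) := \matrix_(i, k) \sum_l t i l *~ gam l k.

Definition torus_haar r d (H : set 'M[circle]_(r, d))
    (h : probability (borel 'M[circle]_(r, d)) R) : Prop :=
  h H = 1%E /\
  forall (t : 'M[circle]_(r, d)) (B : set (borel 'M[circle]_(r, d))),
    H t -> measurable B -> h [set x | B (t + x)] = h B.

(* pi(L_j)^d *)
Definition subtorus d (g : grid_class R d) : set 'M[circle]_(rk g, d) :=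
  [set torus_pi V | V in [set V | forall k, Lgen (col k V)]].

Definition Uq d (g : grid_class R d) (q : 'rV[R]_d) : 'M[R]_(rk g, d) :=
  \matrix_(i, k) (gshift i - (gscale i)^-1 *: (q *m invmx (gmat g))) 0 k.

Definition orbit_cosets d (g : grid_class R d) (q : 'rV[R]_d) :
    set 'M[circle]_(rk g, d) :=
  [set t | exists gam : 'M[int]_d, \det gam = 1 /\
     subtorus (t - torus_act (torus_pi (Uq g q)) gam)].

(* [omega] is omega_j^g: the K cosets [V l + pi(L_j)^d] are pairwise distinct,
   their union is the orbit of cosets, and [omega] is the average of the
   translates to these cosets of the Haar probability [h] on pi(L_j)^d.  The
   choice of [q] is immaterial. *)
Definition generic_measure d (g : grid_class R d)
    (omega : probability (borel 'M[circle]_(rk g, d)) R) : Prop :=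
  exists q : 'rV[R]_d,
  exists K : nat, exists V : 'I_K -> 'M[circle]_(rk g, d),
  exists h : probability (borel 'M[circle]_(rk g, d)) R,
  [/\ forall l l' : 'I_K, l != l' -> ~ subtorus (V l - V l'),
      orbit_cosets q = [set t | exists l, subtorus (t - V l)],
      torus_haar (@subtorus d g) h &
      forall B : set (borel 'M[circle]_(rk g, d)), measurable B ->
        omega B = ((K%:R^-1)%:E * \sum_(l < K) h [set x | B (V l + x)%R])%E].

End Torus.

Section SpecialLinear.
Variable R : realType.

Definition SLR d : set 'M[R]_d := [set A | \det A = 1].

(* Haar measure on SL_d(R), which is unimodular, as a Borel measure on the
   space of d x d matrices that is carried by SL_d(R). *)
Definition SL_haar d (mu : {measure set (borel 'M[R]_d) -> \bar R}) : Prop :=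
  [/\ mu (~` @SLR d) = 0%E,
      (0 < mu (@SLR d))%E,
      forall C : set 'M[R]_d, compact C -> C `<=` @SLR d -> (mu C < +oo)%E,
      forall A (B : set (borel 'M[R]_d)), SLR A -> measurable B ->
        mu [set X | B (A *m X)] = mu B &
      forall A (B : set (borel 'M[R]_d)), SLR A -> measurable B ->
        mu [set X | B (X *m A)] = mu B].

(* Borel fundamental domain for the left action of SL_d(Z). *)
Definition SLZ_fundamental_domain d (F : set (borel 'M[R]_d)) : Prop :=
  [/\ measurable F, F `<=` @SLR d &
      forall A, SLR A ->
        exists! gam : 'M[int]_d, \det gam = 1 /\ F (map_mx intr gam *m A)].

End SpecialLinear.

Section FreePathLength.
Variable R : realType.

(* Mutual independence of the two finite families taken together. *)
Definition independent_families d (T : measurableType d) (P : probability T R)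
    N (dA dU : 'I_N -> measure_display)
    (TA : forall j, measurableType (dA j)) (TU : forall j, measurableType (dU j))
    (A : forall j, {RV P >-> TA j}) (U : forall j, {RV P >-> TU j}) : Prop :=
  forall (a : forall j, set (TA j)) (b : forall j, set (TU j)),
    (forall j, measurable (a j)) -> (forall j, measurable (b j)) ->
    P (\bigcap_j (A j @^-1` a j `&` U j @^-1` b j)) =
    (\prod_(j < N) (P (A j @^-1` a j) * P (U j @^-1` b j)))%E.

(* In what follows the dimension is d = n.+1 and row vectors of length n.+1
   are written (xi, w) with xi : R and w : 'rV_n. *)

Definition unit_ball n : set 'rV[R]_n := [set w | \sum_k w 0 k ^+ 2 < 1].

Definition ball_volume n : R := fine (lebesgue_rV R n (@unit_ball n)).

Definition cylinder n : set (measurableTypeR R * borel 'rV[R]_n) :=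
  [set p | 0 < p.1 /\ unit_ball p.2].

Definition generic_points d (pr : presentation R d)
    (A : forall j : 'I_(nclasses pr), 'M[R]_d)
    (U : forall j : 'I_(nclasses pr), 'M[circle R]_(rk (cls j), d)) :
    set ('rV[R]_d * Psi pr) :=
  [set y | exists v : 'rV[R]_d,
     torus_pi v = row (tagged y.2) (U (tag y.2)) /\
     y.1 = scale y.2 *: (v *m A (tag y.2))].

(* [y = z(Y)] *)
Definition first_point n (I : Type) (Y : set ('rV[R]_n.+1 * I)) y : Prop :=
  [/\ Y y, cylinder (rVuncons y.1) &
      forall y', Y y' -> cylinder (rVuncons y'.1) -> y' <> y ->
        y.1 0 0 < y'.1 0 0].

Definition iota_refl n (p : measurableTypeR R * borel 'rV[R]_n) :
  measurableTypeR R * borel 'rV[R]_n := (p.1, - (p.2 : 'rV[R]_n)).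

Definition density d (pr : presentation R d) (psi : Psi pr) : R :=
  (scale psi) ^- d.

Definition total_density d (pr : presentation R d) : R :=
  \sum_(psi : Psi pr) density psi.

Definition msr d (pr : presentation R d) (psi : Psi pr) : R :=
  density psi / total_density pr.

(* [k] is the kernel k^g of [pr].  Since the set of indices is finite, the
   density property is expressed on the sets [B * {psi}]. *)
Definition transition_kernel n (mu : {measure set (borel 'M[R]_n.+1) -> \bar R})
    (F : set (borel 'M[R]_n.+1)) (pr : presentation R n.+1)
    (omega : forall j : 'I_(nclasses pr),
       probability (borel 'M[circle R]_(rk (cls j), n.+1)) R)
    (k : R -> 'rV[R]_n -> Psi pr -> R) : Prop :=
  [/\ forall xi w psi, 0 < xi -> unit_ball w -> 0 <= k xi w psi,
      forall psi, {within (@cylinder n : set (R * 'rV[R]_n)), continuous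
        (fun p : R * 'rV[R]_n => k p.1 p.2 psi)} &
      exists (dT : measure_display) (T : measurableType dT) (P : probability T R)
        (A : forall j : 'I_(nclasses pr), {RV P >-> borel 'M[R]_n.+1})
        (U : forall j : 'I_(nclasses pr),
           {RV P >-> borel 'M[circle R]_(rk (cls j), n.+1)}),
      let Y t := generic_points (fun j => A j t) (fun j => U j t) in
      [/\ independent_families A U,
          forall j B, measurable B -> distribution P (A j) B = mu (B `&` F),
          forall j B, measurable B -> distribution P (U j) B = omega j B,
          {ae P, forall t, exists y, first_point (Y t) y} &
          forall psi B, measurable B ->
            P [set t | exists y, [/\ first_point (Y t) y, y.2 = psi &
                                     B (iota_refl (rVuncons y.1))]] =
            ((msr psi / ball_volume n)%:E *
             \int[lebesgue_measure \x lebesgue_rV R n]_(p in B `&` @cylinder n)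
               (k p.1 p.2 psi)%:E)%E]].

Definition free_path_density n (pr : presentation R n.+1)
    (k : R -> 'rV[R]_n -> Psi pr -> R) (xi : R) : R :=
  (ball_volume n)^-1 *
  \sum_(psi : Psi pr) msr psi *
    \int[lebesgue_rV R n]_(w in @unit_ball n) k xi w psi.

End FreePathLength.

(* Main.v *)
(* Let G(x) be the probability that the generic configuration has no point in
   ]0, x] * B. The configurations attached to the different commensurability
   classes are independent, so G is the product of the corresponding void
   probabilities of the single classes, and by Tonelli each void probability is
   the tail integral of the free path length density. It remains to see that
   this density is continuous, so that it is minus the derivative of its tail.
   By dominated convergence it suffices that the kernel k is bounded, that is,
   that a small box of volume V with positive first coordinates is hit with
   probability at most C V. The law of a random grid (Z^d + u) A is
   SL_d(R)-invariant, because omega is SL_d(Z)-invariant; so the hitting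
   probability can be averaged over the images of the box under the shears
   (p0, p') |-> (t^-n p0, t (p' + p0 y)), with y in a fine finite grid in
   [0, 1[^n. For a fixed grid and t large, counting grid points in large boxes
   shows that the proportion of the y for which the image is hit is at most C V;
   the hitting indicator being at most 1, dominated convergence as t tends to
   infinity gives the bound, without any appeal to reduction theory or to
   Siegel's mean value theorem. *)

From HB Require Import structures.
Require Import Defs.
From mathcomp Require Import all_boot all_order all_algebra.
From mathcomp Require Import perm generic_quotient ring_quotient.
From mathcomp Require Import zify ring lra.
From mathcomp Require Import all_classical all_reals all_analysis.
From mathcomp Require Import measurable_realfun.
Import Order.TTheory GRing.Theory Num.Theory numFieldNormedType.Exports.
Set Implicit Arguments.
Unset Strict Implicit.
Unset Printing Implicit Defensive.
Local Open Scope classical_set_scope.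
Local Open Scope ring_scope.

(** * Measurability of matrix-valued maps *)

(** The obstacle is uniformity: a grid with a very short basis has many points in a small box, and
    only boxes larger than a scale depending on A see its true density. In [lattice_count] the
    constant is common to all A and only the threshold depends on A, so the threshold disappears in
    the limit over t. The exponents in the shear make the powers of t cancel. Let the box have
    height h, first coordinate at least a, and cross-section a cube of side e. A grid point p whose
    image meets it has p0 of order a t^n in a range of length h t^n, and p' of order a t^n, which
    leaves about h t^n (a t^n)^n points. Each of them is sent into the box only by y in a cube of
    side at most e / (t p0) <= e / (a t^(n+1)). The product is of order h e^n, the volume of the
    box. Each of the kernels [k] and [kj j] comes with a probability space of its own. They are
    compared through void probabilities written as integrals over [F] that involve only [mu] and the
    [omega j]. *)

Section MeasurableMatrices.
Variable R : realType.

(** An open set of matrices is the union of the countably many boxes with rational endpoints that it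
    contains. *)
Lemma measurable_fun_mx d (Z : measurableType d) r c
    (f : Z -> borel 'M[R]_(r, c)) :
  (forall i k, measurable_fun setT (fun z => (f z : 'M[R]_(r, c)) i k)) ->
  measurable_fun setT f.
Proof.
move=> mf; apply: (@measurability _ _ _ _ setT f (@open 'M[R]_(r, c))).
  by [].
move=> _ [U oU <-]; rewrite setTI.
pose box (q : 'M[rat * rat]_(r, c)) : set 'M[R]_(r, c) :=
  [set M | forall i k, ratr (q i k).1 < M i k < ratr (q i k).2].
have -> : f @^-1` U = \bigcup_(q in [set: 'M[rat * rat]_(r, c)])
    [set z | box q (f z) /\ box q `<=` U].
  apply/seteqP; split => [z /= Uz|z [q _ [/= bz]]]; last exact.
  have /nbhs_ballP[e /= e0 eU] := open_nbhs_nbhs (conj oU Uz).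
  have /choice[q Hq] : forall ik : 'I_r * 'I_c, exists q : rat * rat,
      f z ik.1 ik.2 - e < ratr q.1 < f z ik.1 ik.2 /\
      f z ik.1 ik.2 < ratr q.2 < f z ik.1 ik.2 + e.
    move=> [i k] /=.
    have [a xa] : exists a, (ratr a : R) \in `]f z i k - e, f z i k[.
      by apply: rat_in_itvoo; rewrite ltrBlDr ltrDl.
    have [b xb] : exists a, (ratr a : R) \in `]f z i k, f z i k + e[.
      by apply: rat_in_itvoo; rewrite ltrDl.
    by exists (a, b); move: xa xb; rewrite !in_itv.
  exists (\matrix_(i, k) q (i, k)) => //; split.
    move=> i k; rewrite mxE; have [/andP[_ ->] /andP[-> _]] := Hq (i, k).
    by [].
  move=> M bM; apply: eU; split => // i k; rewrite /ball/= ltr_distlC.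
  have := bM i k; rewrite mxE => /andP[h1 h2].
  have [/andP[h3 _] /andP[_ h4]] := Hq (i, k).
  by rewrite (lt_trans h3)//= (lt_trans h2).
apply: countable_bigcupT_measurable => // q.
have [bU|nbU] := pselect (box q `<=` U); last first.
  rewrite (_ : [set _ | _] = set0); first exact: measurable0.
  by apply/seteqP; split => // z [].
rewrite (_ : [set _ | _] = \bigcap_(i in [set: 'I_r]) \bigcap_(k in [set: 'I_c])
    ((fun z => (f z : 'M[R]_(r, c)) i k) @^-1`
      `](ratr (q i k).1), (ratr (q i k).2)[%classic)); last first.
  apply/seteqP; split => [z [bz _] i _ k _|z bz] /=.
    by rewrite in_itv/=; exact: bz.
  split => // i k; have := bz i I k I; by rewrite /= in_itv.
apply: fin_bigcap_measurable => //= i _; apply: fin_bigcap_measurable => //= k _.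
rewrite -[X in measurable X]setTI; exact: mf.
Qed.

Lemma measurable_mx_coord r c (i : 'I_r) (k : 'I_c) :
  measurable_fun setT (fun A : borel 'M[R]_(r, c) => (A : 'M[R]_(r, c)) i k).
Proof.
apply: (measurability _ (measurable_realfun.RGenOpens.measurableE R)).
move=> _ [_ [a [b ->]] <-]; rewrite setTI; apply: sub_sigma_algebra.
have := @interval_open R (BRight a) (BLeft b) isT isT.
by apply: open_comp => x _; exact: coord_continuous.
Qed.

Definition frac (x : R) : R := x - (Num.floor x)%:~R.

Lemma frac_itv x : 0 <= frac x < 1.
Proof.
have := Num.Theory.floor_itv x; rewrite /frac intrD => /andP[? ?].
by rewrite subr_ge0 ltrBlDl; apply/andP.
Qed.

Lemma measurable_frac : measurable_fun setT frac.
Proof.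
apply: measurable_funB => //.
apply: nondecreasing_measurable => //= x y xy.
by rewrite ler_int le_floor.
Qed.

End MeasurableMatrices.

(** * The circle and the torus *)

Section CircleSection.
Variable R : realType.

Lemma frac_eq (x y : R) : 0 <= y < 1 -> x - y \is a Num.int -> frac x = y.
Proof.
move=> /andP[y0 y1] /intrP[m xy]; rewrite /frac.
rewrite (@floor_def _ _ m) ?xy; first by rewrite -xy opprB addrC subrK.
have -> : x = y + m%:~R by rewrite -xy addrC subrK.
by rewrite intrD lerDr y0 addrC ltrD2l.
Qed.

Lemma frac_int (x : R) : x - frac x \is a Num.int.
Proof. by rewrite /frac opprB addrC subrK. Qed.

Lemma circle_pi_is_zmod_morphism : zmod_morphism (@circle_pi R).
Proof. by move=> x y; rewrite /circle_pi raddfB. Qed.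

HB.instance Definition _ := GRing.isZmodMorphism.Build R (circle R)
  (@circle_pi R) circle_pi_is_zmod_morphism.

Lemma circle_piP (x y : R) : circle_pi x = circle_pi y <-> x - y \is a Num.int.
Proof.
have H := @Quotient.idealrBE _ (integers R) x y.
have H' : (x - y \is a Num.int) = (x - y \in integers R) by [].
rewrite H' H; split=> [e|/eqP//]; exact/eqP.
Qed.

(** The representative given by [repr] is arbitrary; its fractional part is the canonical one in [0,
    1[, which makes the section Borel. *)
Definition sec (s : circle R) : R := frac (repr s).

Lemma sec_itv s : 0 <= sec s < 1.
Proof. exact: frac_itv. Qed.

Lemma secK : cancel sec (@circle_pi R).
Proof.
move=> s; rewrite -[RHS](@reprK _ (Quotient.quot (integers R)) s).
apply/circle_piP; rewrite /sec -[_ - _]opprB rpredN; exact: frac_int.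
Qed.

Lemma sec_pi x : sec (circle_pi x) = frac x.
Proof.
apply/esym/frac_eq; first exact: sec_itv.
by apply/circle_piP; rewrite secK.
Qed.

Lemma circle_pi_continuous : continuous (@circle_pi R).
Proof. exact: pi_continuous. Qed.

Lemma circle_openP (U : set (circle R)) : open U <-> open (@circle_pi R @^-1` U).
Proof. by []. Qed.

Lemma open_sec_itv (c : R) : c <= 1 -> open [set s | 0 < sec s < c].
Proof.
move=> c1; apply/circle_openP.
rewrite (_ : _ @^-1` _ = \bigcup_(z in [set: int]) `]z%:~R, (z%:~R + c)[%classic).
  by apply: bigcup_open => z _; exact: interval_open.
apply/seteqP; split => [x /=|x [z _ /=]].
  rewrite sec_pi => /andP[f0 fc]; exists (Num.floor x) => //=.
  by move: f0 fc; rewrite in_itv/= /frac; lra.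
rewrite in_itv/= sec_pi => /andP[zx xz]; rewrite (@frac_eq x (x - z%:~R)).
- by rewrite subr_gt0 zx ltrBlDl.
- by rewrite subr_ge0 ltW//= ltrBlDl (lt_le_trans xz)// lerD2l.
- by rewrite opprB addrC subrK.
Qed.

Lemma measurable_sec : measurable_fun setT (sec : borel (circle R) -> R).
Proof.
apply: (measurability _ (measurable_realfun.RGenOInfty.measurableE R)).
move=> _ [_ [a ->] <-]; rewrite setTI.
have mo c : c <= 1 -> measurable ([set s | 0 < sec s < c] : set (borel (circle R))).
  by move=> c1; apply: sub_sigma_algebra; exact: open_sec_itv.
have [a0|a0] := ltP a 0.
  rewrite (_ : _ @^-1` _ = setT); first exact: measurableT.
  apply/seteqP; split => // s _ /=; rewrite in_itv/= andbT (lt_le_trans a0)//.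
  by have /andP[] := sec_itv s.
have [a1|a1] := leP 1 a.
  rewrite (_ : _ @^-1` _ = set0); first exact: measurable0.
  apply/seteqP; split => // s /=; rewrite in_itv/= andbT => /(le_lt_trans a1).
  by have /andP[_ /ltW] := sec_itv s; rewrite leNgt => /negP.
(* [sec] jumps at the class of [0], so only the sets [0 < sec s < c] are open. *)
rewrite (_ : _ @^-1` _ = [set s | 0 < sec s < 1] `\`
    \bigcap_(i in [set: nat]) [set s | 0 < sec s < Order.min 1 (a + i.+1%:R^-1)]).
  apply: measurableD; first exact: mo.
  by apply: bigcapT_measurable => i; apply: mo; rewrite ge_min lexx.
apply/seteqP; split => [s /=|s [/= /andP[s0 s1] /existsNP[i]]]; rewrite in_itv/= andbT.
  move=> as_; have s0 : 0 < sec s by exact: le_lt_trans as_.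
  have /andP[_ s1] := sec_itv s; split; first by rewrite s0.
  move=> /(_ (Num.trunc (sec s - a)^-1) I) /=; rewrite lt_min => /and3P[_ _].
  rewrite -ltrBlDl => /ltW; apply/negP; rewrite -ltNge.
  rewrite invf_plt ?posrE ?subr_gt0// ?ltr0n//.
  exact: truncnS_gt.
move=> /not_implyP[_] /negP; rewrite s0/= lt_min s1/= -leNgt.
by apply: lt_le_trans; rewrite ltrDl invr_gt0 ltr0n.
Qed.

End CircleSection.

Section TorusBasics.
Variable R : realType.

Lemma closure_subgroup r c (S : set 'M[R]_(r, c)) :
  S 0 -> (forall a b, S a -> S b -> S (a - b)) ->
  closure S 0 /\ forall a b, closure S a -> closure S b -> closure S (a - b).
Proof.
move=> S0 SB; split; first exact: subset_closure.
move=> a b Sa Sb N Nab.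
have : nbhs (a, b) ((fun z : 'M[R]_(r, c) * 'M[R]_(r, c) => z.1 - z.2) @^-1` N).
  by have := @sub_continuous _ (a, b); exact.
case=> -[A B] /= [/Sa[a' [Sa' Aa']] /Sb[b' [Sb' Bb']]] ABN.
exists (a' - b'); split; first exact: SB.
by apply: (ABN (a', b')).
Qed.

(** For b in the component of 0, translating that component by - b gives a connected subset of S
    that contains 0, hence a part of the same component. *)
Lemma component_subgroup r c (S : set 'M[R]_(r, c)) :
  S 0 -> (forall a b, S a -> S b -> S (a - b)) ->
  forall a b, connected_component S 0 a -> connected_component S 0 b ->
    connected_component S 0 (a - b).
Proof.
move=> S0 SB a b La Lb.
pose B := (fun x => x - b) @` connected_component S 0.
have : B `<=` connected_component S 0.
  apply: connected_component_max.
  - by exists b => //; rewrite subrr.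
  - move=> _ [x Lx <-].
    exact: (SB _ _ (connected_component_sub Lx) (connected_component_sub Lb)).
  - apply: connected_continuous_connected; first exact: component_connected.
    apply: continuous_subspaceT => x.
    by apply: (@continuousB _ _ _ (fun x => x) (fun=> b) x);
      [move=> ?; exact|exact: cst_continuous].
by apply; exists a.
Qed.

(** Closedness serves the measurability of [subtorus]; the subgroup property serves its stability
    under differences and under integer combinations of columns. *)
Lemma frakL_subgroup r (S : set 'cV[R]_r) :
  [/\ frakL S 0, forall a b, frakL S a -> frakL S b -> frakL S (a - b) &
      closed (frakL S)].
Proof.
have [G0 GB] : closure (generated_subgroup (S `|` @int_vectors R r)) 0 /\
  forall a b, closure (generated_subgroup (S `|` @int_vectors R r)) a ->
  closure (generated_subgroup (S `|` @int_vectors R r)) b ->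
  closure (generated_subgroup (S `|` @int_vectors R r)) (a - b).
  apply: closure_subgroup; first by move=> H.
  move=> a b Ha Hb H H0 HB SH.
  exact: (HB _ _ (Ha H H0 HB SH) (Hb H H0 HB SH)).
split.
- exact: connected_component_refl.
- exact: component_subgroup.
- by apply: component_closed; exact: closed_closure.
Qed.

Definition torus_sec r d (u : 'M[circle R]_(r, d)) : 'M[R]_(r, d) :=
  map_mx (@sec R) u.

Lemma torus_secK r d : cancel (@torus_sec r d) (@torus_pi R r d).
Proof. by move=> u; apply/matrixP => i k; rewrite !mxE secK. Qed.

Lemma torus_piB r d (V W : 'M[R]_(r, d)) :
  torus_pi (V - W) = torus_pi V - torus_pi W.
Proof. by apply/matrixP => i k; rewrite !mxE raddfB. Qed.

Lemma torus_piP r d (V W : 'M[R]_(r, d)) :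
  torus_pi V = torus_pi W <-> exists m : 'M[int]_(r, d), V = map_mx intr m + W.
Proof.
split=> [/matrixP e|[m ->]].
  have /choice[m Hm] : forall ik : 'I_r * 'I_d, exists m : int,
      V ik.1 ik.2 - W ik.1 ik.2 = m%:~R.
    move=> [i k]; have := e i k; rewrite !mxE => /circle_piP /intrP[m Hm].
    by exists m.
  exists (\matrix_(i, k) m (i, k)); apply/matrixP => i k; rewrite !mxE.
  by rewrite -(Hm (i, k))/= subrK.
apply/matrixP => i k; rewrite !mxE; apply/circle_piP.
by rewrite addrK; exact: intr_int.
Qed.

Lemma torus_pi_continuous r d : continuous (@torus_pi R r d).
Proof.
move=> V N [P NP PN]; exists (fun i k => @circle_pi R @^-1` P i k).
  move=> i k; apply: circle_pi_continuous.
  by have := NP i k; rewrite mxE.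
by move=> W PW; apply: PN => i k; rewrite mxE; exact: PW.
Qed.

Lemma torus_coord_continuous r d i k :
  continuous (fun u : 'M[circle R]_(r, d) => u i k).
Proof.
move=> u N Nu; exists (fun i' k' => [set x | (i', k') = (i, k) -> N x]).
  move=> i' k'; have [[-> ->]|ne] := pselect ((i', k') = (i, k)).
    by apply: filterS Nu => x Nx _.
  by apply: filterS filterT => x _ /ne.
by move=> v; apply.
Qed.

Lemma measurable_sec_coord r d i k : measurable_fun setT
  (fun u : borel 'M[circle R]_(r, d) => sec ((u : 'M[circle R]_(r, d)) i k)).
Proof.
have mc : measurable_fun setT (fun u : borel 'M[circle R]_(r, d) =>
  (u : 'M[circle R]_(r, d)) i k : borel (circle R)); last first.
  exact: (measurableT_comp (@measurable_sec R) mc).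
apply: (@measurability _ _ (borel 'M[circle R]_(r, d)) (borel (circle R))
  setT _ (@open (circle R))); first by [].
move=> _ [U oU <-]; rewrite setTI; apply: sub_sigma_algebra.
by move: oU; apply: open_comp => u _; exact: torus_coord_continuous.
Qed.

Lemma measurable_torus_pi r d :
  measurable_fun setT (@torus_pi R r d : borel _ -> borel _).
Proof.
apply: (@measurability _ _ (borel 'M[R]_(r, d)) (borel 'M[circle R]_(r, d))
  setT _ (@open 'M[circle R]_(r, d))); first by [].
move=> _ [U oU <-]; rewrite setTI; apply: sub_sigma_algebra.
by move: oU; apply: open_comp => u _; exact: torus_pi_continuous.
Qed.

(** Since f is [torus_pi] after [torus_sec] after f, the question is lifted to real matrices, where
    entries suffice. *)
Lemma measurable_fun_torus d0 (Z : measurableType d0) r d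
    (f : Z -> borel 'M[circle R]_(r, d)) :
  (forall i k, measurable_fun setT (fun z => sec ((f z : 'M[circle R]_(r, d)) i k))) ->
  measurable_fun setT f.
Proof.
move=> mf; rewrite (_ : f = @torus_pi R r d \o (@torus_sec r d \o f)).
  apply: (measurableT_comp (@measurable_torus_pi r d)).
  apply: measurable_fun_mx => i k.
  rewrite (_ : (fun _ => _) = fun z => sec ((f z : 'M[circle R]_(r, d)) i k)).
    exact: mf.
  by apply/funext => u; rewrite mxE.
by apply/funext => z /=; rewrite torus_secK.
Qed.

End TorusBasics.

(** * Invariance of the generic measure under SL(d, Z) *)

Section TorusAction.
Variable R : realType.

Lemma torus_act_pi r d (V : 'M[R]_(r, d)) (gam : 'M[int]_d) :
  torus_act (torus_pi V) gam = torus_pi (V *m map_mx intr gam).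
Proof.
apply/matrixP => i k; rewrite !mxE raddf_sum; apply: eq_bigr => l _.
by rewrite !mxE mulrzr raddfMz.
Qed.

Lemma torus_actE r d (t : 'M[circle R]_(r, d)) (gam : 'M[int]_d) :
  torus_act t gam = torus_pi (torus_sec t *m map_mx intr gam).
Proof. by rewrite -torus_act_pi torus_secK. Qed.

Lemma torus_actB r d (t t' : 'M[circle R]_(r, d)) (gam : 'M[int]_d) :
  torus_act (t - t') gam = torus_act t gam - torus_act t' gam.
Proof.
rewrite -[t]torus_secK -[t']torus_secK -torus_piB !torus_act_pi -torus_piB.
by rewrite mulmxBl.
Qed.

Lemma torus_act0 r d (gam : 'M[int]_d) :
  torus_act (0 : 'M[circle R]_(r, d)) gam = 0.
Proof. by rewrite -[X in torus_act X](subrr 0) torus_actB subrr. Qed.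

Lemma torus_actD r d (t t' : 'M[circle R]_(r, d)) (gam : 'M[int]_d) :
  torus_act (t + t') gam = torus_act t gam + torus_act t' gam.
Proof.
by rewrite -{1}[t']opprK -[- t']sub0r !torus_actB torus_act0 sub0r opprK.
Qed.

Lemma torus_actM r d (t : 'M[circle R]_(r, d)) (gam gam' : 'M[int]_d) :
  torus_act t (gam *m gam') = torus_act (torus_act t gam) gam'.
Proof. by rewrite -[t]torus_secK !torus_act_pi map_mxM mulmxA. Qed.

Lemma torus_act1 r d (t : 'M[circle R]_(r, d)) : torus_act t 1%:M = t.
Proof. by rewrite -[t]torus_secK !torus_act_pi map_mx1 mulmx1. Qed.

Lemma measurable_torus_act r d (gam : 'M[int]_d) : measurable_fun setT
  (fun t : borel 'M[circle R]_(r, d) =>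
    torus_act t gam : borel 'M[circle R]_(r, d)).
Proof.
apply: measurable_fun_torus => i k.
rewrite (_ : (fun _ => _) = @frac R \o (fun t : borel 'M[circle R]_(r, d) =>
    \sum_l sec ((t : 'M[circle R]_(r, d)) i l) * (gam l k)%:~R)); last first.
  apply/funext => t /=; rewrite torus_actE mxE sec_pi mxE.
  by congr frac; apply: eq_bigr => l _; rewrite !mxE.
apply: measurableT_comp; first exact: measurable_frac.
apply: measurable_sum => l; apply: measurable_funM => //.
exact: measurable_sec_coord.
Qed.

Lemma measurable_torus_add d0 (Z : measurableType d0) r d
    (f g : Z -> borel 'M[circle R]_(r, d)) :
  measurable_fun setT f -> measurable_fun setT g ->
  measurable_fun setT (fun z =>
    ((f z : 'M[circle R]_(r, d)) + g z) : borel 'M[circle R]_(r, d)).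
Proof.
move=> mf mg; apply: measurable_fun_torus => i k.
rewrite (_ : (fun _ => _) = @frac R \o (fun z =>
    sec ((f z : 'M[circle R]_(r, d)) i k) +
    sec ((g z : 'M[circle R]_(r, d)) i k))); last first.
  apply/funext => z /=; rewrite mxE -sec_pi; congr sec.
  by rewrite (raddfD (@circle_pi R)) /= !secK.
apply: measurableT_comp; first exact: measurable_frac.
apply: measurable_funD.
  exact: (measurableT_comp (@measurable_sec_coord R r d i k) mf).
exact: (measurableT_comp (@measurable_sec_coord R r d i k) mg).
Qed.

Lemma subgroup_sumz (V : zmodType) (S : set V) : S 0 ->
  (forall a b, S a -> S b -> S (a - b)) ->
  forall (I : finType) (f : I -> V) (m : I -> int), (forall i, S (f i)) ->
  S (\sum_i f i *~ m i).
Proof.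
move=> S0 SB.
have SN a : S a -> S (- a) by move=> Sa; rewrite -sub0r; exact: SB.
have SD a b : S a -> S b -> S (a + b).
  by move=> Sa Sb; rewrite -[b]opprK; apply: SB => //; exact: SN.
have SM a n : S a -> S (a *+ n).
  by move=> Sa; elim: n => [|n IH]; rewrite ?mulr0n// mulrS; exact: SD.
move=> I f m Sf; apply: big_ind => // i _; case: (m i) => n; first exact: SM.
by rewrite NegzE mulrNz; apply/SN/SM.
Qed.

Section Subtorus.
Variables (d : nat) (g : grid_class R d).

Lemma subtorus0 : subtorus (0 : 'M[circle R]_(rk g, d)).
Proof.
exists 0; last by apply/matrixP => i k; rewrite !mxE raddf0.
move=> k; have [L0 _ _] := frakL_subgroup
  ([set t *: ctilde g | t in [set: R]] `|` columns (shift_mx g)).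
by rewrite raddf0.
Qed.

Lemma subtorusB (t t' : 'M[circle R]_(rk g, d)) :
  subtorus t -> subtorus t' -> subtorus (t - t').
Proof.
move=> [V LV <-] [W LW <-]; exists (V - W); last by rewrite torus_piB.
have [_ LB _] := frakL_subgroup
  ([set t *: ctilde g | t in [set: R]] `|` columns (shift_mx g)).
by move=> k; rewrite raddfB; exact: (LB _ _ (LV k) (LW k)).
Qed.

(** The columns of V gam are integer combinations of the columns of V, which all lie in the same
    subgroup. *)
Lemma subtorus_act (t : 'M[circle R]_(rk g, d)) (gam : 'M[int]_d) :
  subtorus t -> subtorus (torus_act t gam).
Proof.
move=> [V LV <-]; exists (V *m map_mx intr gam); last by rewrite torus_act_pi.
have [L0 LB _] := frakL_subgroup
  ([set t *: ctilde g | t in [set: R]] `|` columns (shift_mx g)).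
move=> k; rewrite (_ : col k _ = \sum_l col l V *~ gam l k).
  exact: (subgroup_sumz L0 LB).
apply/matrixP => i j; rewrite !mxE summxE; apply: eq_bigr => l _.
rewrite !mxE mulrzr; case: (gam l k) => n; first by rewrite mulmxnE mxE.
by rewrite NegzE !mulrNz [RHS]mxE mulmxnE mxE.
Qed.

End Subtorus.
End TorusAction.

Section GenericMeasureInvariance.
Variables (R : realType) (d : nat) (g : grid_class R d).
Notation torus := 'M[circle R]_(rk g, d).

(** A class lies in the subtorus when some integer translate of its section has all its columns in
    the closed set [Lgen g]: a countable union of Borel conditions. *)
Lemma measurable_subtorus : measurable (@subtorus R d g : set (borel torus)).
Proof.
have [_ _ Lcl] := frakL_subgroup
  ([set t *: ctilde g | t in [set: R]] `|` columns (shift_mx g)).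
have mL : measurable (@Lgen R d g : set (borel 'cV[R]_(rk g))).
  rewrite -[X in measurable X]setCK; apply: measurableC.
  by apply: sub_sigma_algebra; exact: closed_openC.
rewrite (_ : @subtorus R d g = \bigcup_(m in [set: 'M[int]_(rk g, d)])
    \bigcap_(k in [set: 'I_d]) ((fun u : borel torus =>
      col k (map_mx intr m + torus_sec u) : borel 'cV[R]_(rk g)) @^-1` @Lgen R d g)).
  apply: countable_bigcupT_measurable => // m.
  apply: fin_bigcap_measurable => // k _.
  rewrite -[X in measurable X]setTI.
  apply: (_ : measurable_fun _ _) => //.
  apply: measurable_fun_mx => i j.
  rewrite (_ : (fun _ => _) = fun u : borel torus =>
      (m i k)%:~R + sec ((u : torus) i k)); last first.
    by apply/funext => u; rewrite !mxE.
  by apply: measurable_funD => //; exact: measurable_sec_coord.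
apply/seteqP; split => [u [V LV Vu]|u [m _ Lm]].
  have [m Vm] : exists m : 'M[int]_(rk g, d), V = map_mx intr m + torus_sec u.
    by apply/torus_piP; rewrite torus_secK.
  by exists m => // k _ /=; rewrite -Vm; exact: LV.
exists (map_mx intr m + torus_sec u); first by move=> k; exact: Lm.
by rewrite -[RHS]torus_secK; apply/torus_piP; exists m.
Qed.

Section Haar.
Variable h : probability (borel torus) R.
Hypothesis hH : torus_haar (@subtorus R d g) h.

Let ae_subtorus (f : borel torus -> \bar R) (c : \bar R) :
  measurable_fun setT f -> (forall x, subtorus (x : torus) -> f x = c) ->
  (\int[h]_x f x = c)%E.
Proof.
move=> mf fc; rewrite (@ae_eq_integral _ _ _ h setT (cst c))//.
  by rewrite integral_cst// [X in (_ * X)%E](@probability_setT _ _ _ h) mule1.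
exists (~` (@subtorus R d g : set (borel torus))); split.
- by apply: measurableC; exact: measurable_subtorus.
- rewrite [LHS]probability_setC; last exact: measurable_subtorus.
  by rewrite [X in (_ - X)%E]hH.1 subee.
- by move=> x /=; apply: contra_not => Hx _; exact: fc.
Qed.

(* Uniqueness of the Haar measure: integrate the indicator of
   [{(x, y) | x gam + y \in B}] in both orders. *)
Lemma torus_haar_act (gam gam' : 'M[int]_d) (B : set (borel torus)) :
  gam' *m gam = 1%:M -> measurable B ->
  h [set x | B (torus_act x gam)] = h B.
Proof.
move=> g'g mB; have [h1 hT] := hH.
pose W : set (borel torus * borel torus) :=
  [set z | B (torus_act (z.1 : torus) gam + (z.2 : torus))].
have mW : measurable W.
  rewrite -[X in measurable X]setTI.
  have : measurable_fun setT (fun z : borel torus * borel torus =>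
      (torus_act (z.1 : torus) gam + (z.2 : torus)) : borel torus).
    apply: measurable_torus_add; last exact: measurable_snd.
    exact: (measurableT_comp (measurable_torus_act gam) measurable_fst).
  by apply.
have mBg : measurable ([set x | B (torus_act x gam)] : set (borel torus)).
  rewrite -[X in measurable X]setTI.
  exact: (measurable_torus_act gam).
have := indic_fubini_tonelli h h mW.
rewrite indic_fubini_tonelli_FE// indic_fubini_tonelli_GE//.
rewrite (@ae_subtorus _ (h B)); last 2 first.
- exact: measurable_fun_xsection.
- move=> x Hx /=; rewrite -[RHS](hT (torus_act x gam) B)//.
    congr (h _); apply/seteqP; split => y; rewrite /xsection/= inE//.
  exact: subtorus_act.
rewrite (@ae_subtorus _ (h [set x | B (torus_act x gam)]))//.
  exact: measurable_fun_ysection.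
(* As x gam + y = (x + y gam') gam, a translation by y gam' removes y from the other inner
   integral. *)
move=> y Hy /=; rewrite -[RHS](hT (torus_act y gam'))//; last exact: subtorus_act.
congr (h _); apply/seteqP; split => x; rewrite /ysection/= inE /W/=.
  by rewrite torus_actD -torus_actM g'g torus_act1 addrC.
by rewrite torus_actD -torus_actM g'g torus_act1 addrC.
Qed.

End Haar.

(** The action of gam sends cosets of the subtorus to cosets within the orbit, injectively because
    gam' undoes it, so it permutes the finitely many of them. On each coset it is an automorphism
    preserving the Haar probability, up to a translation by an element of the subtorus. *)
Lemma generic_measure_act (omega : probability (borel torus) R)
    (gam gam' : 'M[int]_d) (B : set (borel torus)) :
  generic_measure omega -> \det gam = 1 ->
  gam *m gam' = 1%:M -> gam' *m gam = 1%:M -> measurable B ->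
  omega [set u | B (torus_act u gam)] = omega B.
Proof.
move=> [q [K [V [h [Vdist Vorb hH omegaE]]]]] detg gg' g'g mB.
have mBact : measurable ([set u | B (torus_act u gam)] : set (borel torus)).
  rewrite -[X in measurable X]setTI.
  exact: (measurable_torus_act gam).
rewrite !omegaE//; congr (_ * _)%E.
have /choice[s sP] : forall l, exists l', subtorus (torus_act (V l) gam - V l').
  move=> l.
  have [gam1 [det1 H1]] : orbit_cosets q (V l).
    by rewrite Vorb; exists l; rewrite subrr; exact: subtorus0.
  have : orbit_cosets q (torus_act (V l) gam).
    exists (gam1 *m gam); split; first by rewrite det_mulmx det1 detg mulr1.
    by rewrite torus_actM -torus_actB; exact: subtorus_act.
  by rewrite Vorb.
have s_inj : injective s.
  move=> l l' ss; apply/eqP; apply: contrapT => /negP /Vdist; apply.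
  rewrite -[X in subtorus X]torus_act1 -gg' torus_actM torus_actB.
  apply: subtorus_act.
  by have := subtorusB (sP l) (sP l'); rewrite ss opprB addrA subrK.
rewrite [RHS](reindex_inj s_inj); apply: eq_bigr => l _ /=.
have mBV (v : torus) : measurable ([set z | B (v + z)] : set (borel torus)).
  rewrite -[X in measurable X]setTI.
  have : measurable_fun setT (fun z : borel torus => (v + (z : torus)) : borel torus).
    by apply: measurable_torus_add => //; exact: measurable_id.
  by apply.
transitivity (h [set z | B (torus_act (V l) gam + z)]).
  rewrite -(torus_haar_act hH g'g (mBV _)); congr (h _).
  by apply/seteqP; split => x /=; rewrite torus_actD.
have [_ hT] := hH; rewrite -[RHS](hT _ _ (sP l) (mBV _)); congr (h _).
by apply/seteqP; split => x /=; rewrite addrA (addrC (V (s l))) subrK.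
Qed.

End GenericMeasureInvariance.

(** * Integration over a fundamental domain of SL(d, Z) *)

Section FundamentalDomain.
Variables (R : realType) (d : nat).
Implicit Types (A X : 'M[R]_d) (gam : 'M[int]_d).

Lemma measurable_mulmxr (B : 'M[R]_d) : measurable_fun setT
  (fun A : borel 'M[R]_d => (A : 'M[R]_d) *m B : borel 'M[R]_d).
Proof.
apply: measurable_fun_mx => i k.
rewrite (_ : (fun _ => _) = fun A : borel 'M[R]_d =>
  \sum_l (A : 'M[R]_d) i l * B l k); last by apply/funext => A; rewrite mxE.
apply: measurable_sum => l; apply: measurable_funM => //.
exact: measurable_mx_coord.
Qed.

Lemma measurable_mulmxl (B : 'M[R]_d) : measurable_fun setT
  (fun A : borel 'M[R]_d => B *m (A : 'M[R]_d) : borel 'M[R]_d).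
Proof.
apply: measurable_fun_mx => i k.
rewrite (_ : (fun _ => _) = fun A : borel 'M[R]_d =>
  \sum_l B i l * (A : 'M[R]_d) l k); last by apply/funext => A; rewrite mxE.
apply: measurable_sum => l; apply: measurable_funM => //.
exact: measurable_mx_coord.
Qed.

Lemma SLZ_inv gam : \det gam = 1 ->
  [/\ \det (\adj gam) = 1, gam *m \adj gam = 1%:M & \adj gam *m gam = 1%:M].
Proof.
move=> g1; have gV : gam *m \adj gam = 1%:M by rewrite mul_mx_adj g1.
split=> //; last by rewrite mul_adj_mx g1.
by rewrite -[LHS]mul1r -{1}g1 -det_mulmx gV det1.
Qed.

Lemma SLR_intr gam : \det gam = 1 -> SLR (map_mx intr gam : 'M[R]_d).
Proof. by rewrite /SLR/= -[map_mx _ _]/(map_mx intr _) det_map_mx => ->. Qed.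

Lemma SLR_mul A X : SLR A -> SLR X -> SLR (A *m X).
Proof. by rewrite /SLR/= det_mulmx => -> ->; rewrite mulr1. Qed.

Section Invariance.
Variables (mu : {measure set (borel 'M[R]_d) -> \bar R}).
Hypothesis mu_haar : SL_haar mu.

Lemma SL_haar_integral_mull (B : 'M[R]_d) (D : set (borel 'M[R]_d))
    (f : borel 'M[R]_d -> \bar R) :
  SLR B -> measurable D -> measurable_fun D f -> (forall A, (0 <= f A)%E) ->
  (\int[mu]_(A in D) f A =
   \int[mu]_(A in [set A | D (B *m A)]) f (B *m (A : 'M[R]_d)))%E.
Proof.
move=> SB mD mf f0; have [_ _ _ inv _] := mu_haar.
have := @ge0_integral_pushforward _ _ _ _ R _ (measurable_mulmxl B) mu D f mD mf.
move=> /(_ (fun y _ => f0 y)) <-.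
apply: eq_measure_integral; first exact: (measurable_mulmxl B).
by move=> mphi E mE _; exact/esym/(inv B E SB mE).
Qed.

Lemma SL_haar_integral_mulr (B : 'M[R]_d) (D : set (borel 'M[R]_d))
    (f : borel 'M[R]_d -> \bar R) :
  SLR B -> measurable D -> measurable_fun D f -> (forall A, (0 <= f A)%E) ->
  (\int[mu]_(A in D) f A =
   \int[mu]_(A in [set A : 'M[R]_d | D (A *m B)]) f ((A : 'M[R]_d) *m B))%E.
Proof.
move=> SB mD mf f0; have [_ _ _ _ inv] := mu_haar.
have := @ge0_integral_pushforward _ _ _ _ R _ (measurable_mulmxr B) mu D f mD mf.
move=> /(_ (fun y _ => f0 y)) <-.
apply: eq_measure_integral; first exact: (measurable_mulmxr B).
by move=> mphi E mE _; exact/esym/(inv B E SB mE).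
Qed.

Variable F : set (borel 'M[R]_d).
Hypothesis F_dom : SLZ_fundamental_domain F.

(** By right invariance the second integral is that of f over F B, which is again a fundamental
    domain. Both domains are cut into countably many pieces matched by some gam in SL(d, Z); left
    invariance of mu and of f makes matching pieces contribute equally. *)
Lemma fundamental_domain_integral_mulr (f : borel 'M[R]_d -> \bar R) (B : 'M[R]_d) :
  measurable_fun setT f -> (forall A, (0 <= f A)%E) ->
  (forall A gam, SLR A -> \det gam = 1 -> f (map_mx intr gam *m A) = f A) ->
  SLR B ->
  (\int[mu]_(A in F) f A = \int[mu]_(A in F) f ((A : 'M[R]_d) *m B))%E.
Proof.
move=> mf f0 finv SB; have [mF FSL Fex] := F_dom.
have uB : B \in unitmx by rewrite unitmxE SB unitr1.
have SV : SLR (invmx B) by rewrite /SLR/= det_inv SB invr1.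
pose FB : set (borel 'M[R]_d) := [set X : 'M[R]_d | F (X *m invmx B)].
have mFB : measurable FB.
  by rewrite -[X in measurable X]setTI; exact: (measurable_mulmxr (invmx B)).
have -> : (\int[mu]_(A in F) f ((A : 'M[R]_d) *m B) = \int[mu]_(A in FB) f A)%E.
  rewrite (SL_haar_integral_mulr SB mFB)//; last exact: measurable_funTS.
  congr integral; apply/seteqP; split => A; rewrite /FB/= -mulmxA mulmxV// mulmx1//.
have FBSL X : FB X -> SLR X.
  by move=> /FSL H; rewrite -[X](mulmxKV uB); exact: SLR_mul.
(* Natural numbers enumerate the integer matrices, so that countable additivity applies; an index
   that decodes to no matrix of determinant 1 gives empty pieces. Left multiplication by gam carries
   G i onto H i. *)
pose e i : option 'M[int]_d := pickle_inv i.
pose G i : set (borel 'M[R]_d) := [set A | exists2 gam : 'M[int]_d,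
  e i = Some gam /\ \det gam = 1 & F A /\ FB (map_mx intr gam *m A)].
pose H i : set (borel 'M[R]_d) := [set X | exists2 gam : 'M[int]_d,
  e i = Some gam /\ \det gam = 1 & FB X /\ F (map_mx intr (\adj gam) *m X)].
have uniqF A gam gam' : SLR A -> \det gam = 1 -> \det gam' = 1 ->
    F (map_mx intr gam *m A) -> F (map_mx intr gam' *m A) -> gam = gam'.
  move=> SA g1 g1' Fg Fg'; have [x [_ ux]] := Fex A SA.
  by rewrite -(ux gam)//; exact: ux.
have mG i : measurable (G i).
  case ei : (e i) => [gam|]; last first.
    rewrite (_ : G i = set0)//; apply/seteqP; split => // A [gam []].
    by rewrite ei.
  have [g1|g1] := pselect (\det gam = 1); last first.
    rewrite (_ : G i = set0)//; apply/seteqP; split => // A [gam' []].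
    by rewrite ei => -[<-].
  rewrite (_ : G i = F `&` (fun A => map_mx intr gam *m (A : 'M[R]_d)) @^-1` FB).
    apply: measurableI => //; rewrite -[X in measurable X]setTI.
    exact: measurable_mulmxl.
  apply/seteqP; split => A [].
    by move=> gam' [+ _] []; rewrite ei => -[<-].
  by move=> FA FBA; exists gam.
have mH i : measurable (H i).
  case ei : (e i) => [gam|]; last first.
    rewrite (_ : H i = set0)//; apply/seteqP; split => // A [gam []].
    by rewrite ei.
  have [g1|g1] := pselect (\det gam = 1); last first.
    rewrite (_ : H i = set0)//; apply/seteqP; split => // A [gam' []].
    by rewrite ei => -[<-].
  rewrite (_ : H i = FB `&`
      (fun A => map_mx intr (\adj gam) *m (A : 'M[R]_d)) @^-1` F).
    apply: measurableI => //; rewrite -[X in measurable X]setTI.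
    exact: measurable_mulmxl.
  apply/seteqP; split => A [].
    by move=> gam' [+ _] []; rewrite ei => -[<-].
  by move=> FA FBA; exists gam.
have intrM gam gam' A : map_mx intr gam *m (map_mx intr gam' *m A) =
    map_mx intr (gam *m gam') *m A.
  by rewrite mulmxA map_mxM.
have intr1 A : map_mx intr (1%:M : 'M[int]_d) *m A = A.
  by rewrite map_mx1 mul1mx.
have eP i gam : e i = Some gam -> pickle gam = i.
  by rewrite /e => ei; have := @pickle_invK 'M[int]_d i; rewrite ei.
have tG : trivIset setT G.
  apply/trivIsetP => i j _ _ /eqP ij; apply/seteqP; split => // A [].
  move=> [gam [ei g1] [FA FBA]] [gam' [ej g1'] [_ FBA']]; apply: ij.
  rewrite -(eP _ _ ei) -(eP _ _ ej); congr pickle.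
  apply: (uniqF (A *m invmx B)) => //; last 2 first.
  - by rewrite mulmxA.
  - by rewrite mulmxA.
  - by apply: SLR_mul => //; exact: FSL.
have tH : trivIset setT H.
  apply/trivIsetP => i j _ _ /eqP ij; apply/seteqP; split => // A [].
  move=> [gam [ei g1] [FA FBA]] [gam' [ej g1'] [_ FBA']]; apply: ij.
  rewrite -(eP _ _ ei) -(eP _ _ ej); congr pickle.
  have [a1 m1 _] := SLZ_inv g1; have [a1' _ m1'] := SLZ_inv g1'.
  have aa : \adj gam = \adj gam' by apply: (uniqF A) => //; exact: FBSL.
  by rewrite -[gam]mulmx1 -m1' -aa mulmxA m1 mul1mx.
have UG : \bigcup_i G i = F.
  apply/seteqP; split => [A [i _ [gam _ []]]//|A FA].
  have SA : SLR (A *m invmx B) by apply: SLR_mul => //; exact: FSL.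
  have [gam [[g1 Fg] _]] := Fex _ SA.
  exists (pickle gam) => //; exists gam; first by rewrite /e pickleK_inv.
  by split => //; rewrite /FB/= -mulmxA.
have UH : \bigcup_i H i = FB.
  apply/seteqP; split => [A [i _ [gam _ []]]//|A FA].
  have [gam [[g1 Fg] _]] := Fex _ (FBSL _ FA).
  have [a1 m1 m1'] := SLZ_inv g1; have [_ _ m2] := SLZ_inv a1.
  have aa : \adj (\adj gam) = gam.
    by rewrite -[LHS]mulmx1 -m1' mulmxA m2 mul1mx.
  exists (pickle (\adj gam)) => //; exists (\adj gam).
    by rewrite /e pickleK_inv.
  by rewrite aa.
rewrite -UG -UH !ge0_integral_bigcup//; [|exact: measurable_funTS..].
apply: eq_eseriesr => i _.
case ei : (e i) => [gam|]; last first.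
  have -> : G i = set0.
    by apply/seteqP; split => // A [gam []]; rewrite ei.
  have -> : H i = set0.
    by apply/seteqP; split => // A [gam []]; rewrite ei.
  by rewrite !integral_set0.
have [g1|g1] := pselect (\det gam = 1); last first.
  have -> : G i = set0.
    by apply/seteqP; split => // A [gam' []]; rewrite ei => -[<-].
  have -> : H i = set0.
    by apply/seteqP; split => // A [gam' []]; rewrite ei => -[<-].
  by rewrite !integral_set0.
have [a1 m1 m1'] := SLZ_inv g1.
rewrite (SL_haar_integral_mull (SLR_intr g1) (mH i))//; last exact: measurable_funTS.
have -> : [set A : 'M[R]_d | H i (map_mx intr gam *m A)] = G i.
  apply/seteqP; split => A /=.
    move=> [gam' [+ _] [FBA]]; rewrite ei => -[<-].
    by rewrite intrM m1' intr1 => FA; exists gam.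
  move=> [gam' [+ _] [FA]]; rewrite ei => -[<-] FBA.
  by exists gam => //; rewrite intrM m1' intr1.
apply: eq_integral => A; rewrite inE => -[gam' _ [FA _]].
by rewrite finv//; exact: FSL.
Qed.

End Invariance.
End FundamentalDomain.

(** * Counting lattice points *)

Section LatticePointCount.
Variable R : realType.

Lemma size_le_fibers (T T' : eqType) (f : T -> T') (s : seq T) (L : seq T')
    (M : R) :
  (forall x, x \in s -> f x \in L) ->
  (forall y, y \in L -> (count (fun x => f x == y) s)%:R <= M) ->
  (size s)%:R <= (size L)%:R * M.
Proof.
move=> sL cM.
have : (size s <= \sum_(y <- L) count (fun x => f x == y) s)%N.
  elim: s sL {cM} => [|x s IH] sL //=; rewrite big_split/= -addn1 addnC.
  apply: leq_add; last by apply: IH => z zs; apply: sL; rewrite inE zs orbT.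
  have fx : f x \in L by apply: sL; rewrite inE eqxx.
  by rewrite (big_rem _ fx)/= eqxx.
rewrite -(ler_nat R) => /le_trans; apply; elim: L {sL} cM => [|y L IH] cM.
  by rewrite big_nil mul0r.
rewrite big_cons /= -addn1 !natrD mulrDl mul1r addrC lerD//.
  by apply: IH => z zL; apply: cM; rewrite inE zL orbT.
by apply: cM; rewrite inE eqxx.
Qed.

Lemma size_int_itv (s : seq int) (x y : R) : uniq s -> x <= y ->
  (forall m, m \in s -> x <= m%:~R <= y) -> (size s)%:R <= y - x + 1.
Proof.
move=> us xy sxy; pose a := Num.ceil x; pose b := Num.floor y.
have sab m : m \in s -> a <= m <= b.
  by move=> /sxy/andP[xm my]; rewrite ceil_le_int floor_ge_int xm my.
have [ba|ab] := ltP b a.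
  have -> : s = [::].
    case: s sab {us sxy} => // m s /(_ m); rewrite inE eqxx => /(_ isT).
    by move=> /andP[am /(le_trans am)]; rewrite leNgt ba.
  by rewrite /= addr_ge0// subr_ge0.
have : (size s <= `|b - a|.+1)%N.
  rewrite -(size_map (fun m => `|m - a|%N)) -(size_iota 0 `|b - a|.+1).
  apply: uniq_leq_size.
    rewrite map_inj_in_uniq// => m m' /sab/andP[am _] /sab/andP[am' _]; lia.
  by move=> _ /mapP[m /sab/andP[am mb] ->]; rewrite mem_iota; lia.
rewrite -(ler_nat R) => /le_trans; apply.
rewrite -natr1 lerD2r natr_absz ger0_norm ?subr_ge0// rmorphB lerB//.
  exact: floor_le.
exact: ceil_ge.
Qed.

(** The order of the quantifiers matters: C is fixed before A, and only the radius from which the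
    bound holds may depend on A. *)
Let bounded_count (C : R) d (A : 'M[R]_d) := exists2 r0 : R, 0 < r0 &
  forall r, r0 <= r -> forall s : seq 'rV[int]_d, uniq s ->
    (forall v, v \in s -> forall k, `|(map_mx intr v *m A) 0 k| <= r) ->
    (size s)%:R <= C * r ^+ d / `|\det A|.

(* Gaussian elimination of the first row: its pivot [A 0 0] bounds the number
   of possible first coordinates, the Schur complement the other ones. *)
Lemma lattice_count_pivot (C : R) d (A : 'M[R]_(1 + d)) : 0 < C ->
  (forall B : 'M[R]_d, \det B != 0 -> bounded_count C B) ->
  A 0 0 != 0 -> (forall k, `|A 0 k| <= `|A 0 0|) -> \det A != 0 ->
  bounded_count (3 * 2 ^+ d * C) A.
Proof.
move=> C0 IH A0 Amax dA; set a := A 0 0.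
have a0 : 0 < `|a| by rewrite normr_gt0.
pose B : 'M[R]_d := drsubmx A - dlsubmx A *m (a^-1 *: ursubmx A).
have AE : A = block_mx 1%:M 0 (a^-1 *: dlsubmx A) 1%:M *m
    block_mx a%:M (ursubmx A) 0 B.
  rewrite mulmx_block !mul1mx !mul0mx !addr0.
  rewrite -[LHS]submxK; congr block_mx.
  - by rewrite [LHS]mx11_scalar; congr (_%:M); rewrite !mxE; congr (A _ _);
      apply/val_inj.
  - by rewrite mul_mx_scalar scalerA mulfV// scale1r.
  - by rewrite /B -scalemxAl -scalemxAr addrC subrK.
have detA : \det A = a * \det B.
  by rewrite AE det_mulmx det_lblock det_ublock !det1 !mul1r det_scalar1.
have dB : \det B != 0 by move: dA; rewrite detA mulf_eq0 => /norP[].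
have [r0 r00 Hr] := IH B dB.
(* The condition |a| <= r absorbs the extra 1 in the count of first coordinates: 2 r / |a| + 1 <= 3
   r / |a|. *)
exists (Num.max r0 `|a|); first by rewrite lt_max r00.
move=> r; rewrite ge_max => /andP[r0r ar] s us sr.
have r_gt0 : 0 < r by exact: lt_le_trans ar.
pose f (v : 'rV[int]_(1 + d)) : 'rV[int]_d := rsubmx v.
have E0 (v : 'rV[int]_(1 + d)) : (map_mx intr v *m A) 0 0 =
    (v 0 0)%:~R * a + (map_mx intr (rsubmx v) *m dlsubmx A) 0 0.
  rewrite mxE big_split_ord/= big_ord1 !mxE; congr (_ + _).
    by congr ((v _ _)%:~R * A _ _); apply/val_inj.
  apply: eq_bigr => l _; rewrite !mxE; congr (_ * A _ _); exact/val_inj.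
have E1 (v : 'rV[int]_(1 + d)) k : (map_mx intr v *m A) 0 (rshift 1 k) =
    (v 0 0)%:~R * ursubmx A 0 k + (map_mx intr (rsubmx v) *m drsubmx A) 0 k.
  rewrite mxE big_split_ord/= big_ord1 !mxE; congr (_ + _).
    by congr ((v _ _)%:~R * A _ _); apply/val_inj.
  by apply: eq_bigr => l _; rewrite !mxE.
(* Each coordinate of (f v) B is a coordinate of v A minus a multiple of the first one; maximality
   of the pivot bounds the multiplier by 1, whence the radius 2 r. *)
have sB : (size (undup (map f s)))%:R <= C * (2 * r) ^+ d / `|\det B|.
  apply: Hr; [by lra|exact: undup_uniq|].
  move=> w; rewrite mem_undup => /mapP[v vs ->] k.
  have -> : (map_mx intr (f v) *m B) 0 k =
      (map_mx intr v *m A) 0 (rshift 1 k) -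
      (map_mx intr v *m A) 0 0 * (ursubmx A 0 k / a).
    rewrite E0 E1 /B -/(f v) mulmxBr -!scalemxAr mulmxA.
    move: (map_mx _ _ *m drsubmx A) (map_mx _ _ *m dlsubmx A) (ursubmx A).
    move=> X Y Z; rewrite !mxE big_ord1; field.
    by rewrite -normr_gt0.
  apply: (le_trans (ler_normB _ _)); rewrite [2 * r]mulr_natl mulr2n lerD ?sr//.
  rewrite normrM -[leRHS]mulr1 ler_pM// ?sr// normf_div ler_pdivrMr// mul1r.
  have -> : ursubmx A 0 k = A 0 (rshift 1 k).
    by rewrite !mxE; congr (A _ _); exact/val_inj.
  exact: Amax.
have := @size_le_fibers _ _ f s (undup (map f s)) (3 * r / `|a|).
move=> /(_ _ _)/le_trans; apply.
- by move=> v vs; rewrite mem_undup map_f.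
- move=> w _; rewrite -size_filter.
  set sw := [seq v <- s | f v == w].
  rewrite -(size_map (fun v : 'rV[int]_(1 + d) => v 0 0)).
  pose b := (map_mx intr w *m dlsubmx A) 0 0.
  (* The pivot may be negative, hence the min and max of the two endpoints. *)
  pose x := Num.min ((- r - b) / a) ((r - b) / a).
  pose y := Num.max ((- r - b) / a) ((r - b) / a).
  have xyE : y - x = 2 * r / `|a|.
    rewrite /x /y; have [a_gt0|a_le0] := ltP 0 a.
      have h : (- r - b) / a <= (r - b) / a.
        by rewrite ler_pM2r ?invr_gt0// lerD2r; lra.
      by rewrite min_l// max_r// gtr0_norm//; field.
    have a_lt0 : a < 0 by rewrite lt_neqAle a_le0 A0.
    have h : (r - b) / a <= (- r - b) / a.
      by rewrite ler_nM2r ?invr_lt0// lerD2r; lra.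
    by rewrite min_r// max_l// ltr0_norm//; field.
  have xy : x <= y by rewrite -subr_ge0 xyE divr_ge0// mulr_ge0// ltW.
  apply: (@le_trans _ _ (y - x + 1)).
    apply: size_int_itv => //.
      rewrite map_inj_in_uniq ?filter_uniq// => v v'.
      rewrite !mem_filter => /andP[/eqP fv _] /andP[/eqP fv' _] vv'.
      rewrite -[v]hsubmxK -[v']hsubmxK; congr row_mx; last by rewrite -/(f v) fv -fv'.
      apply/rowP => i; rewrite !mxE ord1.
      by move: vv'; congr (_ = _); congr (_ _ _); apply/val_inj.
    move=> _ /mapP[v + ->]; rewrite mem_filter => /andP[/eqP fv vs].
    have := sr v vs 0; rewrite E0 -/(f v) fv -/b ler_norml => /andP[h1 h2].
    rewrite /x /y; have [a_gt0|a_le0] := ltP 0 a.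
      rewrite ge_min le_max !ler_pdivrMr// !ler_pdivlMr//.
      by apply/andP; split; apply/orP; [left|right]; lra.
    have a_lt0 : a < 0 by rewrite lt_neqAle a_le0 A0.
    rewrite ge_min le_max !ler_ndivrMr// !ler_ndivlMr//.
    by apply/andP; split; apply/orP; [right|left]; lra.
  rewrite xyE (_ : 3 * r / `|a| = 2 * r / `|a| + r / `|a|); last by field; rewrite gt_eqF.
  by rewrite lerD2l ler_pdivlMr// mul1r.
have -> : 3 * 2 ^+ d * C * r ^+ (1 + d) / `|\det A| =
    C * (2 * r) ^+ d / `|\det B| * (3 * r / `|a|).
  rewrite detA normrM exprMn exprS; field.
  by rewrite !gt_eqF// normr_gt0.
by rewrite ler_wpM2r// divr_ge0// mulr_ge0// ltW.
Qed.

(** Swapping columns brings the largest entry of the first row, nonzero because the determinant is,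
    to the pivot position. This only permutes the coordinates of the lattice points, so it preserves
    both the cube and the absolute value of the determinant. *)
Lemma lattice_count_linear d : exists2 C : R, 0 < C &
  forall A : 'M[R]_d, \det A != 0 -> bounded_count C A.
Proof.
elim: d => [|d [C C0 IH]].
  exists 1 => // A _; exists 1 => // r _ s us _.
  rewrite det_mx00 normr1 expr0 mulr1 divr1 (ler_nat _ _ 1).
  have /uniq_leq_size : {subset s <= [:: 0]}.
    by move=> v _; rewrite inE; apply/eqP/rowP => -[].
  exact.
exists (3 * 2 ^+ d * C); first by rewrite !mulr_gt0// exprn_gt0.
move=> A dA.
have [k kmax] : exists k, forall l, `|A 0 l| <= `|A 0 k|.
  have [k _ H] := @Order.TotalTheory.arg_maxP _ _ _ (0 : 'I_d.+1) xpredT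
    (fun k => `|A 0 k|) isT.
  by exists k => l; exact: H.
have Ak : A 0 k != 0.
  apply: contra dA => /eqP Ak0; rewrite (expand_det_row A 0) big1// => l _.
  have := kmax l; rewrite Ak0 normr0 normr_le0 => /eqP ->.
  by rewrite mul0r.
have dA' : `|\det (xcol 0 k A)| = `|\det A|.
  rewrite xcolE det_mulmx det_perm normrM normrX normrN1 expr1n mulr1//.
have xE i l : xcol 0 k A i l = A i (tperm 0 k l) by rewrite mxE.
have [|||r0 r00 Hr] := @lattice_count_pivot C d (xcol 0 k A) C0 IH.
- by rewrite xE tpermL.
- by move=> l; rewrite !xE tpermL.
- by rewrite -normr_gt0 dA' normr_gt0.
exists r0 => // r r0r s us sr; rewrite -dA'; apply: Hr => // v vs l.
have -> : (map_mx intr v *m xcol 0 k A) 0 l = (map_mx intr v *m A) 0 (tperm 0 k l).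
  by rewrite !mxE; apply: eq_bigr => m _; rewrite xE.
exact: sr.
Qed.

(** Subtracting one member of s from all of them removes the shift u and the centre y at the price
    of a cube of radius 2 r, whence the factor 2 ^+ d. *)
Lemma lattice_count d : exists2 C : R, 0 < C &
  forall A : 'M[R]_d, \det A != 0 -> exists2 r0 : R, 0 < r0 &
  forall r, r0 <= r -> forall (u y : 'rV[R]_d) (s : seq 'rV[int]_d), uniq s ->
    (forall v, v \in s ->
      forall k, `|((map_mx intr v + u) *m A) 0 k - y 0 k| <= r) ->
    (size s)%:R <= C * r ^+ d / `|\det A|.
Proof.
have [C C0 HC] := lattice_count_linear d.
exists (C * 2 ^+ d); first by rewrite mulr_gt0// exprn_gt0.
move=> A dA; have [r0 r00 Hr] := HC A dA; exists r0 => // r r0r u y [|v0 s] us sr.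
  by rewrite /= divr_ge0// mulr_ge0 ?exprn_ge0 ?mulr_ge0 ?exprn_ge0 ?ltW// (lt_le_trans r00).
rewrite -(size_map (fun v => v - v0)) -mulrA -mulrA (mulrA _ (r ^+ d)) -exprMn mulrA.
apply: Hr; first by have := r00; lra.
  by rewrite map_inj_uniq// => v v' /addIr.
move=> _ /mapP[v vs ->] k.
have -> : map_mx intr (v - v0) *m A = ((map_mx intr v + u) *m A - y) -
    ((map_mx intr v0 + u) *m A - y).
  by rewrite opprB addrA subrK -mulmxBl opprD addrACA subrr addr0 map_mxB.
rewrite mxE [X in _ + X]mxE; apply: (le_trans (ler_normB _ _)).
have H w : w \in v0 :: s -> `|((map_mx intr w + u) *m A - y) 0 k| <= r.
  by move=> ws; have := sr w ws k; rewrite [X in _ -> `|X| <= _]mxE [X in _ -> `|_ + X| <= _]mxE.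
by rewrite mulr_natl mulr2n lerD// H// inE eqxx.
Qed.

End LatticePointCount.

(** * Averaging over shears *)

Section Averaging.
Variables (R : realType) (n : nat).

Definition box (a h : R) (w : 'rV[R]_n) (e : R) : set 'rV[R]_n.+1 :=
  [set p | a <= p 0 0 < a + h /\
    forall k : 'I_n, w 0 k <= p 0 (lift ord0 k) < w 0 k + e].

Definition hits d (A : 'M[R]_d) (t : 'rV[circle R]_d) (S : set 'rV[R]_d) : Prop :=
  exists v : 'rV[R]_d, torus_pi v = t /\ S (v *m A).

(* [(p0, p') |-> (t^-n p0, t (p' + p0 x))] *)
Definition shear (t : R) (x : 'rV[R]_n) : 'M[R]_(1 + n) :=
  block_mx (t ^- n)%:M (t *: x) 0 t%:M.

Lemma shear_det t x : t != 0 -> SLR (shear t x : 'M[R]_n.+1).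
Proof.
move=> t0; rewrite /SLR/= [LHS](@det_ublock _ 1 n) !det_scalar expr1 mulVf//.
by rewrite expf_neq0.
Qed.

Lemma ord0_lshift : (0 : 'I_n.+1) = lshift n (0 : 'I_1).
Proof. exact/val_inj. Qed.

Lemma lift0_rshift (k : 'I_n) : lift ord0 k = rshift 1 k.
Proof. exact/val_inj. Qed.

Lemma mul_block_coord (p : 'rV[R]_n.+1) a (x : 'rV[R]_n) c :
  let q : 'rV[R]_n.+1 := p *m (block_mx a%:M x 0 c%:M : 'M[R]_(1 + n)) in
  q 0 0 = a * p 0 0 /\
  forall k, q 0 (lift ord0 k) = p 0 0 * x 0 k + c * p 0 (lift ord0 k).
Proof.
move=> q; have -> : q = row_mx (a *: lsubmx (p : 'rV[R]_(1 + n)))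
    (lsubmx (p : 'rV[R]_(1 + n)) *m x + c *: rsubmx (p : 'rV[R]_(1 + n))).
  rewrite /q -[p in LHS](@hsubmxK _ _ 1 n) [LHS](@mul_row_block _ _ 1 n 1 n).
  by rewrite mulmx0 addr0 !mul_mx_scalar.
split.
  by rewrite ord0_lshift [LHS](@row_mxEl _ 1 1 n) !mxE.
by move=> k; rewrite lift0_rshift ord0_lshift [LHS](@row_mxEr _ 1 1 n) !mxE big_ord1 !mxE.
Qed.

Lemma mul_shear0 (p : 'rV[R]_n.+1) t x : (p *m shear t x) 0 0 = t ^- n * p 0 0.
Proof. by have [-> _] := mul_block_coord p (t ^- n) (t *: x) t. Qed.

Lemma mul_shearS (p : 'rV[R]_n.+1) t x k :
  (p *m shear t x) 0 (lift ord0 k) = t * (p 0 (lift ord0 k) + p 0 0 * x 0 k).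
Proof.
have [_ ->] := mul_block_coord p (t ^- n) (t *: x) t.
by rewrite mxE; ring.
Qed.

Lemma card_ffun_le q (S : 'I_n -> pred 'I_q) (M : R) :
  (forall k, #|S k|%:R <= M) -> #|family S|%:R <= M ^+ n.
Proof.
move=> SM; rewrite card_family foldrE big_image/= natr_prod.
rewrite -[leRHS]/(M ^+ n) -[X in _ <= M ^+ X](card_ord n) -prodr_const.
by apply: ler_prod => k _; rewrite ler0n SM.
Qed.

Lemma card_ord_itv q (x y : R) (S : pred 'I_q) : x <= y ->
  (forall i, S i -> x <= i%:R <= y) -> #|S|%:R <= y - x + 1.
Proof.
move=> xy Sxy; rewrite cardE -(size_map (fun i : 'I_q => (i : nat)%:Z)).
apply: size_int_itv => //.
  by rewrite map_inj_uniq ?enum_uniq// => i j [] /val_inj.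
by move=> _ /mapP[i + ->]; rewrite mem_enum => /Sxy.
Qed.

(* For large [t] the images meeting the box come from points [p] of the grid in a
   box of size [t^n]; each [p] is responsible for few [x], and the determinant of
   the grid makes the resulting bound uniform in [A]. *)
Lemma shear_average : (0 < n)%N -> exists2 K : R, 0 < K &
  forall (a h e : R) (w : 'rV[R]_n) (A : 'M[R]_n.+1),
    0 < h -> h <= a -> 0 < e -> SLR A ->
  exists t0 : nat, forall t : nat, (t0 <= t)%N ->
  forall q : nat, a * t%:R ^+ n.+1 / e <= q%:R ->
  forall tt : 'rV[circle R]_n.+1,
    #|[pred x : {ffun 'I_n -> 'I_q} | `[< hits
        (A *m shear t%:R (\row_k ((x k)%:R / q%:R))) tt (box a h w e) >]]|%:R
    <= q%:R ^+ n * (K * h * e ^+ n).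
Proof.
move=> n_gt0; have [C C0 HC] := lattice_count R n.+1.
(* The 1 / 2 and a factor 3 ^+ n come from 1 / \det D, and the remaining 2 ^+ n from the count of
   the x attached to one grid point. *)
exists (C * 6 ^+ n / 2); first by rewrite divr_gt0// mulr_gt0// exprn_gt0.
move=> a h e w A h0 ha e0 SA.
have a0 : 0 < a by exact: lt_le_trans ha.
(* D rescales the region of the possible points p, where a t^n <= p0 < (a + h) t^n and |p'| <= 3 a
   t^n, to a cube of radius t^n. *)
pose D : 'M[R]_n.+1 := block_mx (2 / h)%:M 0 0 (3 * a)^-1%:M : 'M[R]_(1 + n).
have detD : \det D = 2 / h * (3 * a) ^- n.
  by rewrite [LHS](@det_ublock _ 1 n) !det_scalar expr1 exprVn.
have dD0 : 0 < \det D.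
  by rewrite detD mulr_gt0 ?divr_gt0// invr_gt0 exprn_gt0// mulr_gt0.
have dAD : \det (A *m D) != 0 by rewrite det_mulmx SA mul1r gt_eqF.
have [r0 r00 Hr] := HC _ dAD.
pose b := \sum_k `|w 0 k| + e.
have b0 : 0 < b by rewrite ltr_wpDl// sumr_ge0.
(* As n >= 1, t > r0 makes t^n an allowed radius for the count. From t > b / a follows b <= a t, so
   p' + p0 x has coordinates at most a; with |p0 x| <= 2 a t^n, where h <= a is used, this gives
   |p'| <= 3 a t^n. *)
exists (Num.trunc (Num.max r0 (b / a))).+1 => t t0t q hq tt.
have [r0t bt] : r0 < t%:R /\ b / a < t%:R.
  have : Num.max r0 (b / a) < t%:R.
    by apply: lt_le_trans (truncnS_gt _) _; rewrite ler_nat.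
  by rewrite gt_max => /andP[].
have t_gt0 : 0 < t%:R :> R by exact: lt_trans r0t.
have t_ge1 : 1 <= t%:R :> R by rewrite ler1n -(ltr0n R).
have tn_gt0 : 0 < t%:R ^+ n :> R by rewrite exprn_gt0.
have tn_get : t%:R <= t%:R ^+ n :> R.
  by rewrite -[leLHS]expr1; apply: ler_weXn2l.
have q_gt0 : 0 < q%:R :> R.
  by apply: lt_le_trans hq; rewrite divr_gt0// mulr_gt0// exprn_gt0.
set X := [pred x | _].
pose u := torus_sec tt.
pose xr (x : {ffun 'I_n -> 'I_q}) : 'rV[R]_n := \row_k ((x k)%:R / q%:R).
pose Pm (m : 'rV[int]_n.+1) x :=
  box a h w e ((map_mx intr m + u) *m (A *m shear t%:R (xr x))).
have /choice[m mP] : forall x, exists m : 'rV[int]_n.+1, x \in X -> Pm m x.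
  move=> x; have [xX|nxX] := boolP (x \in X); last by exists 0.
  have /asboolP[v [vt Sv]] := xX.
  have [m vm] : exists m : 'rV[int]_n.+1, v = map_mx intr m + u.
    by apply/torus_piP; rewrite torus_secK.
  by exists m => _; rewrite /Pm -vm.
have PmE m0 x : Pm m0 x -> let p := (map_mx intr m0 + u) *m A in
    a * t%:R ^+ n <= p 0 0 < (a + h) * t%:R ^+ n /\
    forall k, w 0 k <= t%:R * (p 0 (lift ord0 k) + p 0 0 * ((x k)%:R / q%:R)) < w 0 k + e.
  move=> Pm0 p; move: Pm0; rewrite /Pm mulmxA -/p => -[Pa Pk]; split.
    by move: Pa; rewrite mul_shear0 mulrC ler_pdivlMr// ltr_pdivrMr.
  by move=> k; have := Pk k; rewrite mul_shearS /xr [(\row_k _) 0 k]mxE.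
pose L := undup [seq m x | x <- enum X].
have sL : (size L)%:R <= C * (t%:R ^+ n) ^+ n.+1 / `|\det (A *m D)|.
  apply: (Hr _ (ltW (lt_le_trans r0t tn_get)) u
    (\row_k (if k == 0 then t%:R ^+ n * (2 * a / h + 1) else 0))).
    exact: undup_uniq.
  move=> m0; rewrite mem_undup => /mapP[x]; rewrite mem_enum => xX ->.
  have [] := PmE _ _ (mP x xX); set p := (_ + u) *m A => /andP[pa pb] Pk k.
  have [D0 DS] := mul_block_coord p (2 / h) 0 (3 * a)^-1.
  rewrite mulmxA -/p [(\row_k _) 0 k]mxE; case: (unliftP ord0 k) => [l ->|->]; last first.
    rewrite eqxx D0 ler_norml.
    have -> : 2 / h * p 0 0 - t%:R ^+ n * (2 * a / h + 1) =
        (2 * (p 0 0 - a * t%:R ^+ n) - h * t%:R ^+ n) / h by field; rewrite gt_eqF.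
    rewrite ler_pdivlMr// ler_pdivrMr// mulNr [_ * h]mulrC.
    by apply/andP; split; nra.
  rewrite [_ == 0]eq_sym (negPf (neq_lift _ _)) subr0 DS [X in p 0 0 * X]mxE mulr0 add0r normrM.
  rewrite gtr0_norm ?invr_gt0 ?mulr_gt0// mulrC ler_pdivrMr ?mulr_gt0//.
  have /andP[wl we] := Pk l.
  have p0 : 0 < p 0 0 by apply: lt_le_trans pa; rewrite mulr_gt0.
  have wb : `|w 0 l| + e <= b.
    by rewrite lerD2r (bigD1 l)//= lerDl sumr_ge0.
  have [wl1 wl2] : - `|w 0 l| <= w 0 l /\ w 0 l <= `|w 0 l|.
    by rewrite ler_norm lerNl -normrN ler_norm.
  have ba : b <= a * t%:R by rewrite -ler_pdivrMl// mulrC ltW.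
  set z := (x l)%:R / q%:R in wl we.
  have [z0 z1] : 0 <= z /\ z <= 1.
    rewrite /z divr_ge0 ?ler0n//; split => //.
    by rewrite ler_pdivrMr// mul1r ler_nat ltnW.
  have s1 : `|p 0 (lift ord0 l) + p 0 0 * z| <= a.
    have : t%:R * `|p 0 (lift ord0 l) + p 0 0 * z| <= a * t%:R.
      apply: le_trans ba; rewrite -[X in X * `|_|]gtr0_norm// -normrM ler_norml.
      by apply/andP; split; lra.
    by rewrite mulrC ler_pM2r.
  have s2 : `|p 0 0 * z| <= 2 * a * t%:R ^+ n.
    rewrite ger0_norm ?mulr_ge0// ?ltW//.
    by have : p 0 0 * z <= p 0 0 * 1 by [rewrite ler_wpM2l// ltW|]; nra.
  have -> : p 0 (lift ord0 l) = p 0 (lift ord0 l) + p 0 0 * z - p 0 0 * z by ring.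
  apply: (le_trans (ler_normB _ _)); apply: (le_trans (lerD s1 s2)).
  have : 1 <= t%:R ^+ n :> R by exact: le_trans tn_get.
  nra.
(* For a fixed grid point p, every coordinate of the shear parameter is confined to an interval of
   length e / (t p0), and p0 >= a t^n. *)
have cM : forall y, y \in L -> (count (fun x => m x == y) (enum X))%:R <=
    (2 * q%:R * e / (a * t%:R ^+ n.+1)) ^+ n.
  move=> m0 _; pose p := (map_mx intr m0 + u) *m A.
  have [p0a|p0a] := ltP (p 0 0) (a * t%:R ^+ n).
    rewrite (_ : count _ _ = 0%N).
      by rewrite exprn_ge0// divr_ge0// !mulr_ge0// ltW.
    apply/eqP; rewrite -leqn0 leqNgt -has_count; apply/hasPn => x.
    rewrite mem_enum => xX; apply/eqP => mx.
    by have [] := PmE _ _ (mP x xX); rewrite mx -/p leNgt p0a.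
  pose S k : pred 'I_q := fun i =>
    w 0 k <= t%:R * (p 0 (lift ord0 k) + p 0 0 * (i%:R / q%:R)) < w 0 k + e.
  have p0 : 0 < p 0 0 by apply: lt_le_trans p0a; rewrite mulr_gt0.
  apply: (@le_trans _ _ #|family S|%:R).
    rewrite ler_nat -size_filter cardE; apply: uniq_leq_size.
      by rewrite filter_uniq// enum_uniq.
    move=> x; rewrite mem_filter !mem_enum => /andP[/eqP mx xX].
    apply/familyP => k; have [_ Pk] := PmE _ _ (mP x xX).
    by have := Pk k; rewrite mx.
  apply: card_ffun_le => k.
  pose c := q%:R / (p 0 0 * t%:R).
  have c0 : 0 < c by rewrite divr_gt0// mulr_gt0.
  pose y := (w 0 k - t%:R * p 0 (lift ord0 k)) * c.
  have ec : e * c <= q%:R * e / (a * t%:R ^+ n.+1).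
    rewrite /c mulrA [e * _]mulrC ler_pM2l ?mulr_gt0// lef_pV2 ?posrE ?mulr_gt0// ?exprn_gt0//.
    by rewrite exprSr mulrA ler_pM2r.
  (* This is the fineness condition on q: it absorbs the extra 1 of [card_ord_itv] and yields the
     factor 2. *)
  have ge1 : 1 <= q%:R * e / (a * t%:R ^+ n.+1).
    rewrite ler_pdivlMr ?mulr_gt0 ?exprn_gt0// mul1r.
    by rewrite -ler_pdivrMr.
  apply: (@le_trans _ _ (y + e * c - y + 1)).
    apply: card_ord_itv; first by rewrite lerDl mulr_ge0// ltW.
    move=> i /andP[h1 h2].
    have iE : i%:R = (t%:R * (p 0 (lift ord0 k) + p 0 0 * (i%:R / q%:R)) -
        t%:R * p 0 (lift ord0 k)) * c.
      by rewrite /c; field; rewrite !gt_eqF.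
    by rewrite iE /y -mulrDl !ler_pM2r//; apply/andP; split; lra.
  rewrite [y + _]addrC addrK -[2 * _ * _]mulrA -[leRHS]mulrA mulr_natl mulr2n.
  exact: lerD.
have := size_le_fibers _ cM; rewrite -cardE => /(_ _)/le_trans; apply.
  by move=> x xX; rewrite mem_undup map_f.
move: sL; rewrite det_mulmx SA mul1r gtr0_norm// detD => sL.
apply: (@le_trans _ _ (C * (t%:R ^+ n) ^+ n.+1 / (2 / h * (3 * a) ^- n) *
   (2 * q%:R * e / (a * t%:R ^+ n.+1)) ^+ n)).
  by rewrite ler_wpM2r// exprn_ge0// divr_ge0// !mulr_ge0// ltW.
rewrite le_eqVlt; apply/orP; left; apply/eqP.
rewrite (_ : 6 = 3 * 2); last by ring.
rewrite !(exprMn, exprVn) -!exprM mulnC; field.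
by rewrite !gt_eqF ?exprn_gt0.
Qed.

End Averaging.

(** * The probability of hitting a small box *)

Section HitBound.
Variables (R : realType).

(** The sum is the expected number of events that occur. *)
Lemma prob_sum_le d (T : measurableType d) (P : probability T R) (I : finType)
    (E : I -> set T) (M : R) : 0 <= M -> (forall i, measurable (E i)) ->
  (forall u, #|[pred i | `[< E i u >]]|%:R <= M) ->
  (\sum_i P (E i) <= M%:E)%E.
Proof.
move=> M0 mE EM.
have -> : (\sum_i P (E i) = \int[P]_u (\sum_i (\1_(E i) u)%:E))%E.
  rewrite ge0_integral_sum//; last first.
  - by move=> i; apply/measurable_EFinP; exact: measurable_indic.
  - by apply: eq_bigr => i _; rewrite integral_indic// setIT.
rewrite -[leRHS]mule1 -[X in (_ * X)%E](@probability_setT _ _ _ P) -integral_cst//.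
apply: ge0_le_integral => //.
- by move=> u _; apply: sume_ge0 => i _; rewrite lee_fin.
- by apply: emeasurable_sum => i; apply/measurable_EFinP; exact: measurable_indic.
- move=> u _; rewrite sumEFin lee_fin; apply: le_trans (EM u).
  rewrite -sum1_card natr_sum [leRHS]big_mkcond/=; apply: ler_sum => i _.
  rewrite indicE inE; have [Eu|nEu] := pselect (E i u).
    by rewrite (mem_set Eu) asboolT.
  by rewrite memNset// asboolF.
Qed.

Section OneClass.
Variables (d : nat) (g : grid_class R d).
Notation torus := 'M[circle R]_(rk g, d).

(** Using the section of u as base point indexes the random grid by the countable type of integer
    vectors, so that events about the grid become countable unions of events about its points. *)
Definition grid_point (i : 'I_(rk g)) (m : 'rV[int]_d)
    (z : borel 'M[R]_d * borel torus) : borel 'rV[R]_d :=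
  (map_mx intr m + row i (torus_sec (z.2 : torus))) *m (z.1 : 'M[R]_d).

Lemma measurable_grid_point i m : measurable_fun setT (grid_point i m).
Proof.
apply: measurable_fun_mx => j k.
rewrite (_ : (fun _ => _) = fun z : borel 'M[R]_d * borel torus =>
   \sum_l ((m 0 l)%:~R + sec ((z.2 : torus) i l)) * (z.1 : 'M[R]_d) l k).
  apply: measurable_sum => l; apply: measurable_funM.
    apply: measurable_funD => //.
    exact: (measurableT_comp (@measurable_sec_coord R _ _ i l) measurable_snd).
  exact: (measurableT_comp (@measurable_mx_coord R _ _ l k) measurable_fst).
apply/funext => z; rewrite mxE; apply: eq_bigr => l _.
by rewrite !mxE ord1.
Qed.

Lemma torus_pi_row (u : torus) (i : 'I_(rk g)) (v : 'rV[R]_d) :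
  torus_pi v = row i u <->
  exists m : 'rV[int]_d, v = map_mx intr m + row i (torus_sec u).
Proof.
have -> : row i u = torus_pi (row i (torus_sec u)).
  by apply/rowP => k; rewrite !mxE secK.
exact: torus_piP.
Qed.

Lemma hitsE (A : 'M[R]_d) (u : torus) i (S : set 'rV[R]_d) :
  hits A (row i u) S <-> exists m, S (grid_point i m (A, u)).
Proof.
split=> [[v [/torus_pi_row[m ->] Sv]]|[m Sm]]; first by exists m.
by exists (map_mx intr m + row i (torus_sec u)); split => //; apply/torus_pi_row; exists m.
Qed.

Definition hit_set i (S : set 'rV[R]_d) : set (borel 'M[R]_d * borel torus) :=
  [set z | hits z.1 (row i (z.2 : torus)) S].

Lemma measurable_hit_set i (S : set (borel 'rV[R]_d)) :
  measurable S -> measurable (hit_set i S).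
Proof.
move=> mS; rewrite (_ : hit_set i S = \bigcup_(m in [set: 'rV[int]_d])
    (grid_point i m @^-1` S)).
  apply: countable_bigcupT_measurable => // m.
  by rewrite -[X in measurable X]setTI; exact: measurable_grid_point.
apply/seteqP; split => [[A u] /hitsE[m]|[A u] [m _]].
  by exists m.
by move=> Sm; apply/hitsE; exists m.
Qed.

(** The grid of gam A with shift u is the grid of A with shift u gam. This turns the invariance of
    omega into left invariance in A of the hitting probability given A. *)
Lemma hits_act (A : 'M[R]_d) (u : torus) i (S : set 'rV[R]_d) (gam : 'M[int]_d) :
  \det gam = 1 ->
  hits (map_mx intr gam *m A) (row i u) S <-> hits A (row i (torus_act u gam)) S.
Proof.
move=> g1; have [_ m1 m1'] := SLZ_inv g1.
have rowact (x : torus) (gam' : 'M[int]_d) :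
    row i (torus_act x gam') = torus_act (row i x) gam'.
  by apply/rowP => k; rewrite !mxE; apply: eq_bigr => l _; rewrite mxE.
rewrite rowact; split=> -[v [vu Sv]].
  exists (v *m map_mx intr gam); rewrite -mulmxA; split => //.
  by rewrite -torus_act_pi vu.
exists (v *m map_mx intr (\adj gam)); split.
  by rewrite -torus_act_pi vu -torus_actM m1 torus_act1.
by rewrite mulmxA -(mulmxA v) -map_mxM m1' map_mx1 mulmx1.
Qed.

End OneClass.

Lemma measurable_box n (a h : R) w e :
  measurable (box a h w e : set (borel 'rV[R]_n.+1)).
Proof.
rewrite (_ : box a h w e =
    (fun p : borel 'rV[R]_n.+1 => (p : 'rV[R]_n.+1) 0 0) @^-1` `[a, a + h[%classic `&`
    \bigcap_(k in [set: 'I_n])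
      ((fun p : borel 'rV[R]_n.+1 => (p : 'rV[R]_n.+1) 0 (lift ord0 k)) @^-1`
        `[w 0 k, w 0 k + e[%classic)).
  apply: measurableI.
    by rewrite -[X in measurable X]setTI; apply: measurable_mx_coord.
  apply: fin_bigcap_measurable => // k _.
  by rewrite -[X in measurable X]setTI; apply: measurable_mx_coord.
apply/seteqP; split => [p [pa pk]|p [pa pk]].
  by split => [|k _] /=; rewrite in_itv/=.
split; first by move: pa; rewrite /= in_itv.
by move=> k; have := pk k I; rewrite /= in_itv.
Qed.

End HitBound.

Section HitProbability.
Variables (R : realType) (n : nat).
Variables (mu : {measure set (borel 'M[R]_n.+1) -> \bar R})
  (F : set (borel 'M[R]_n.+1)).
Hypotheses (mu_haar : SL_haar mu) (F_dom : SLZ_fundamental_domain F).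
Variable pA : probability (borel 'M[R]_n.+1) R.
Hypothesis pAE : forall B, measurable B -> pA B = mu (B `&` F).

Lemma integral_domain (f : borel 'M[R]_n.+1 -> \bar R) :
  measurable_fun setT f -> (forall A, (0 <= f A)%E) ->
  (\int[pA]_A f A = \int[mu]_(A in F) f A)%E.
Proof.
move=> mf f0; have [mF _ _] := F_dom.
have mFC : measurable (~` F) by exact: measurableC.
rewrite (@ge0_negligible_integral _ _ _ pA setT (~` F))//; last first.
  by rewrite [LHS]pAE// setICl measure0.
rewrite setTD setCK; apply: eq_measure_integral => B mB BF.
by rewrite [LHS]pAE// (setIidl BF).
Qed.

Lemma mu_domain : mu F = 1%E.
Proof.
by have := pAE measurableT; rewrite setTI => <-; rewrite [LHS]probability_setT.
Qed.

Variables (g : grid_class R n.+1)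
  (omega : probability (borel 'M[circle R]_(rk g, n.+1)) R).
Hypothesis omega_gen : generic_measure omega.
Variable i : 'I_(rk g).

Let theta (S : set (borel 'rV[R]_n.+1)) (A : borel 'M[R]_n.+1) : \bar R :=
  omega (xsection (hit_set i S) A).

Let thetaE S A : theta S A =
  omega [set u | hits (A : 'M[R]_n.+1) (row i (u : 'M[circle R]_(rk g, n.+1))) S].
Proof. by congr (omega _); apply/seteqP; split => u; rewrite /xsection/= inE. Qed.

Let mhits (S : set (borel 'rV[R]_n.+1)) (A : 'M[R]_n.+1) : measurable S ->
  measurable ([set u | hits A (row i (u : 'M[circle R]_(rk g, n.+1))) S]
    : set (borel 'M[circle R]_(rk g, n.+1))).
Proof.
move=> mS; have := measurable_xsection (A : borel _) (measurable_hit_set i mS).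
by congr measurable; apply/seteqP; split => u; rewrite /xsection/= inE.
Qed.

Let measurable_theta (S : set (borel 'rV[R]_n.+1)) : measurable S -> measurable_fun setT (theta S).
Proof. by move=> mS; apply: measurable_fun_xsection; exact: measurable_hit_set. Qed.

Let theta_inv (S : set (borel 'rV[R]_n.+1)) A gam : measurable S -> \det gam = 1 ->
  theta S (map_mx intr gam *m (A : 'M[R]_n.+1)) = theta S A.
Proof.
move=> mS g1; have [_ m1 m1'] := SLZ_inv g1.
rewrite !thetaE -(generic_measure_act omega_gen g1 m1 m1' (mhits A mS)).
by congr (omega _); apply/seteqP; split => u /=; rewrite hits_act.
Qed.

(** Given A, the hitting probability is SL(d, Z)-invariant in A, so right translation by any s x
    leaves its integral over F unchanged: all terms of the sum integrate to the same value. *)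
Lemma hit_probability_average (S : set (borel 'rV[R]_n.+1)) (I : finType)
    (s : I -> 'M[R]_n.+1) :
  measurable S -> (forall x, SLR (s x)) ->
  (#|I|%:R%:E * (pA \x omega) (hit_set i S) =
   \int[mu]_(A in F) (\sum_x theta S ((A : 'M[R]_n.+1) *m s x)))%E.
Proof.
move=> mS Ss; rewrite ge0_integral_sum//; last first.
- move=> x; apply: measurable_funTS.
  exact: (measurableT_comp (measurable_theta mS) (measurable_mulmxr (s x))).
- by have [] := F_dom.
rewrite (eq_bigr (fun=> (pA \x omega)%E (hit_set i S))); last first.
  move=> x _; rewrite -(fundamental_domain_integral_mulr mu_haar F_dom _ _ _ (Ss x))//.
  - by rewrite -integral_domain//; exact: measurable_theta.
  - exact: measurable_theta.
  - by move=> A gam _ g1; rewrite theta_inv.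
by rewrite sumr_const mule_natl.
Qed.

(* The threshold for [k] depends on [A], but the averaged hitting probabilities
   are at most [1], so dominated convergence over the domain applies. *)
Lemma hit_probability_le (S : set (borel 'rV[R]_n.+1)) (c : R)
    (I : nat -> finType) (s : forall k, I k -> 'M[R]_n.+1) :
  measurable S -> 0 <= c -> (forall k, (0 < #|I k|)%N) ->
  (forall k x, SLR (s k x)) ->
  (forall A : 'M[R]_n.+1, SLR A -> \forall k \near \oo,
    forall t : 'rV[circle R]_n.+1,
      #|[pred x : I k | `[< hits (A *m s k x) t S >]]|%:R <= #|I k|%:R * c) ->
  ((pA \x omega) (hit_set i S) <= c%:E)%E.
Proof.
move=> mS c0 I0 Ss H; have [mF FS _] := F_dom.
pose N k : R := #|I k|%:R.
have N0 k : 0 < N k by rewrite ltr0n.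
pose G k (A : borel 'M[R]_n.+1) : \bar R :=
  (((N k)^-1)%:E * \sum_x theta S ((A : 'M[R]_n.+1) *m s k x))%E.
have mG k : measurable_fun setT (G k).
  apply: measurable_funeM; apply: emeasurable_sum => x.
  exact: (measurableT_comp (measurable_theta mS) (measurable_mulmxr (s k x))).
have G0 k A : (0 <= G k A)%E.
  by apply: mule_ge0; [rewrite lee_fin invr_ge0 ltW|exact: sume_ge0].
have G1 k A : (G k A <= 1)%E.
  rewrite /G muleC lee_pdivrMr// mul1e.
  rewrite (_ : (N k)%:E = (\sum_(x : I k) 1)%E); last first.
    by rewrite sumr_const -[LHS]mule1 mule_natl.
  apply: lee_sum => x _; apply: probability_le1; apply: measurable_xsection.
  exact: measurable_hit_set.
have pG k : ((pA \x omega) (hit_set i S) = \int[mu]_(A in F) G k A)%E.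
  rewrite ge0_integralZl//; last 3 first.
  - apply: measurable_funTS; apply: emeasurable_sum => x.
    exact: (measurableT_comp (measurable_theta mS) (measurable_mulmxr (s k x))).
  - by move=> A _; apply: sume_ge0.
  - by rewrite lee_fin invr_ge0 ltW.
  rewrite -hit_probability_average// muleA -EFinM mulVf ?mul1e//.
  by rewrite pnatr_eq0 -lt0n.
(* The averages G k A are eventually at most c but need not converge; their maximum with c is
   eventually equal to c, so it has a pointwise limit and still dominates G. *)
pose phi k A := maxe (G k A) c%:E.
have [_ _ cv] : [/\ mu.-integrable F (cst c%:E),
  [sequence \int[mu]_(A in F) `|phi k A - c%:E|]_k @ \oo --> 0 &
  [sequence \int[mu]_(A in F) phi k A]_k @ \oo --> \int[mu]_(A in F) c%:E]%E.
  apply: (@dominated_convergence _ _ _ mu F mF phi (cst c%:E) (cst (1 + c)%:E)).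
  - by move=> k; apply: measurable_funTS; apply: measurable_maxe.
  - by [].
  - apply: aeW => A FA.
    have HA := H A (FS _ FA).
    apply: cvg_near_cst; apply: filterS HA => k HA.
    apply/max_idPr; rewrite /G muleC lee_pdivrMr// -EFinM.
    under eq_bigr do rewrite thetaE.
    apply: prob_sum_le => //.
    + by rewrite mulr_ge0// ltW.
    + by move=> x; exact: mhits.
    + by move=> u; rewrite mulrC; exact: HA.
  - apply/integrableP; split => //.
    under eq_integral do rewrite /=.
    by rewrite integral_cst// [mu F]mu_domain mule1 ltry.
  - apply: aeW => A k _; rewrite gee0_abs ?le_max ?G0//.
    rewrite ge_max; apply/andP; split.
      by apply: le_trans (G1 k A) _; rewrite lee_fin lerDl.
    by rewrite lee_fin lerDr.
have -> : c%:E = (\int[mu]_(A in F) c%:E)%E.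
  by rewrite integral_cst// [mu F]mu_domain mule1.
rewrite -(cvg_lim _ cv)//; apply: lime_ge; first by apply/cvg_ex; exists (\int[mu]_(A in F) c%:E)%E.
apply: nearW => k; rewrite (pG k); apply: ge0_le_integral => //.
- exact: measurable_funTS.
- by apply: measurable_funTS; exact: measurable_maxe.
- by move=> A _; rewrite le_max lexx.
Qed.

End HitProbability.

Lemma hit_probability_box (R : realType) (n : nat) : (0 < n)%N ->
  exists2 K : R, 0 < K &
  forall (mu : {measure set (borel 'M[R]_n.+1) -> \bar R}) F
    (pA : probability (borel 'M[R]_n.+1) R) (g : grid_class R n.+1)
    (omega : probability (borel 'M[circle R]_(rk g, n.+1)) R),
  SL_haar mu -> SLZ_fundamental_domain F ->
  (forall B, measurable B -> pA B = mu (B `&` F)) ->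
  generic_measure omega ->
  forall (i : 'I_(rk g)) (a h e : R) (w : 'rV[R]_n), 0 < h -> h <= a -> 0 < e ->
  ((pA \x omega) (hit_set i (box a h w e)) <= (K * h * e ^+ n)%:E)%E.
Proof.
move=> n_gt0; have [K K0 HK] := @shear_average R n n_gt0; exists K => //.
move=> mu F pA g omega mu_haar F_dom pAE omega_gen i a h e w h0 ha e0.
have a0 : 0 < a by exact: lt_le_trans ha.
(* With t = k.+1, nonzero so that the shear is defined, this q meets the fineness condition of
   [shear_average] and is positive, so the average is over a nonempty set. *)
pose q k := (Num.trunc (a * k.+1%:R ^+ n.+1 / e)).+1.
apply: (@hit_probability_le R n mu F mu_haar F_dom pA pAE g omega omega_gen i
  _ _ (fun k => {ffun 'I_n -> 'I_(q k)})
  (fun k x => shear k.+1%:R (\row_j ((x j)%:R / (q k)%:R)))).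
- exact: measurable_box.
- by rewrite !mulr_ge0 ?exprn_ge0// ltW.
- by move=> k; rewrite card_ffun !card_ord expn_gt0.
- by move=> k x; exact: shear_det.
move=> A SA; have [t0 Ht] := HK a h e w A h0 ha e0 SA.
exists t0 => // k /= t0k tt.
rewrite card_ffun !card_ord natrX; apply: Ht.
  by rewrite (leq_trans t0k).
by rewrite ltW// truncnS_gt.
Qed.

(** * Independence *)

Section Independence.
Context (R : realType) (dT : measure_display) (T : measurableType dT)
  (P : probability T R).

(** Two finite measures that agree on the pi-system of rectangles are equal. X is an event carried
    along, to be filled by the conditions on the other classes, and c is its weight. *)
Lemma pair_law d1 d2 (T1 : measurableType d1) (T2 : measurableType d2)
    (p1 : probability T1 R) (p2 : probability T2 R)
    (f : T -> T1) (g : T -> T2) (X : set T) (c : {nonneg R}) :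
  measurable_fun setT f -> measurable_fun setT g -> measurable X ->
  (forall a b, measurable a -> measurable b ->
    P (X `&` (f @^-1` a `&` g @^-1` b)) = ((c%:num)%:E * (p1 a * p2 b))%E) ->
  forall W, measurable W ->
    P (X `&` (fun t => (f t, g t)) @^-1` W) = ((c%:num)%:E * (p1 \x p2) W)%E.
Proof.
move=> mf mg mX H W mW.
have mfg : measurable_fun setT (fun t => (f t, g t)) by exact: measurable_fun_pair.
pose pf : {measure set (T1 * T2)%type -> \bar R} :=
  pushforward (mrestr P mX) (fun t => (f t, g t)).
pose m1 := pf mfg.
pose m2 : {measure set (T1 * T2)%type -> \bar R} := mscale c (p1 \x p2)%E.
have -> : P (X `&` (fun t => (f t, g t)) @^-1` W) = m1 W.
  by rewrite /m1/pf/= /pushforward /mrestr setIC.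
rewrite -[RHS]/(m2 W).
pose G : set (set (T1 * T2)) :=
  [set A `*` B | A in measurable & B in measurable].
have Gm12 a b : measurable a -> measurable b -> m1 (a `*` b) = m2 (a `*` b).
  move=> ma mb; rewrite /m1/pf/= /pushforward /mrestr/= setIC.
  by rewrite /m2/= /mscale/= product_measure1E// -H.
apply: (measure_unique G (fun=> setT)) => //.
- exact: measurable_prod_measurableType.
- move=> _ _ [a1 ma1 [b1 mb1 <-]] [a2 ma2 [b2 mb2 <-]]; rewrite -setXI.
  exists (a1 `&` a2); first exact: measurableI.
  by exists (b1 `&` b2) => //; exact: measurableI.
- by move=> _; exists setT => //; exists setT => //; rewrite setXTT.
- by rewrite bigcup_const//.
- by move=> _ [a ma [b mb <-]]; exact: Gm12.
- move=> _; rewrite /m1/pf/= /pushforward /mrestr/=.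
  apply: le_lt_trans (ltry 1); apply: probability_le1.
  by rewrite preimage_setT setTI.
Qed.

Context (N : nat) (dA dU : 'I_N -> measure_display)
  (TA : forall j, measurableType (dA j)) (TU : forall j, measurableType (dU j))
  (A : forall j, {RV P >-> TA j}) (U : forall j, {RV P >-> TU j})
  (pA : forall j, probability (TA j) R) (pU : forall j, probability (TU j) R).
Hypothesis AU_indep : independent_families A U.
Hypothesis A_law : forall j a, measurable a -> P (A j @^-1` a) = pA j a.
Hypothesis U_law : forall j b, measurable b -> P (U j @^-1` b) = pU j b.

Let good j (D : set T) (p : \bar R) := exists2 W, measurable W &
  D = (fun t => (A j t, U j t)) @^-1` W /\ p = (pA j \x pU j)%E W.

Let rgood j (D : set T) (p : \bar R) := exists a b, [/\ measurable a, measurable b,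
  D = A j @^-1` a `&` U j @^-1` b & p = (pA j a * pU j b)%E].

Let rgood_good j D p : rgood j D p -> good j D p.
Proof.
move=> [a [b [ma mb -> ->]]]; exists (a `*` b); first exact: measurableX.
by split => //; rewrite product_measure1E.
Qed.

Let good_measurable j D p : good j D p -> measurable D.
Proof.
move=> [W mW [-> _]]; rewrite -[X in measurable X]setTI.
have mfg : measurable_fun setT (fun t => (A j t, U j t)).
  by apply: measurable_fun_pair.
exact: mfg.
Qed.

Let good_p j D p : good j D p -> exists c : {nonneg R}, p = (c%:num)%:E.
Proof.
move=> [W mW [_ ->]].
have p0 : (0 <= (pA j \x pU j) W)%E by [].
have p1 : ((pA j \x pU j) W <= 1)%E.
  apply: (@le_trans _ _ ((pA j \x pU j)%E setT)); first by apply: le_measure => //; rewrite inE.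
  rewrite -setXTT product_measure1E//.
  by rewrite [X in (X * _)%E]probability_setT [X in (_ * X)%E]probability_setT mule1.
have pfin : (pA j \x pU j)%E W \is a fin_num.
  by rewrite ge0_fin_numE// (le_lt_trans p1)// ltry.
exists (NngNum (fine_ge0 p0)); by rewrite /= fineK.
Qed.

(** Independence is given on rectangles ([rgood]) and extended to arbitrary measurable sets of pairs
    ([good]) one class at a time: the first k classes are arbitrary, the others rectangles. The
    inductive step applies [pair_law] to class k, with X the conditions on all other classes. *)
Let independent_upto k : forall (D : 'I_N -> set T) (p : 'I_N -> \bar R),
  (forall j : 'I_N, (j < k)%N -> good j (D j) (p j)) ->
  (forall j : 'I_N, (k <= j)%N -> rgood j (D j) (p j)) ->
  P (\bigcap_j D j) = (\prod_j p j)%E.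
Proof.
elim: k => [|k IH] D p gD rD.
  have H j := rD j (leq0n _).
  pose a j := projT1 (cid (H j)).
  pose b j := projT1 (cid (projT2 (cid (H j)))).
  have abP j : [/\ measurable (a j), measurable (b j),
      D j = A j @^-1` a j `&` U j @^-1` b j & p j = (pA j (a j) * pU j (b j))%E].
    exact: projT2 (cid (projT2 (cid (H j)))).
  have -> : \bigcap_j D j = \bigcap_j (A j @^-1` a j `&` U j @^-1` b j).
    by apply: eq_bigcapr => j _; have [_ _ ->] := abP j.
  rewrite AU_indep; last 2 first.
  - by move=> j; have [] := abP j.
  - by move=> j; have [] := abP j.
  by apply: eq_bigr => j _; have [ma mb _ ->] := abP j; rewrite A_law// U_law.
have [kN|Nk] := ltnP k N; last first.
  apply: IH => j jk; first by apply: gD; rewrite ltnS ltnW.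
  by have := ltn_ord j; rewrite ltnNge (leq_trans Nk).
pose j0 := Ordinal kN.
pose X := \bigcap_(j in [set j | j != j0]) D j.
have DX (E : set T) : \bigcap_j (if j == j0 then E else D j) = X `&` E.
  apply/seteqP; split => [t Dt|t [Xt Et] j _].
    split; last by have := Dt j0 I; rewrite eqxx.
    by move=> j /= jj0; have := Dt j I; rewrite (negPf jj0).
  by case: eqP => // /eqP jj0; exact: Xt.
have all_good j : good j (D j) (p j).
  have [jk|kj] := ltnP j k.+1; first exact: gD.
  by apply: rgood_good; exact: rD.
have mX : measurable X.
  apply: fin_bigcap_measurable; first exact: finite_finset.
  by move=> j _; exact: good_measurable (all_good j).
have [c cE] : exists c : {nonneg R}, (\prod_(j | j != j0) p j)%E = (c%:num)%:E.
  elim/big_ind: _ => [|x y [c1 ->] [c2 ->]|j _]; first by exists 1%:nng.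
    by exists (c1%:num * c2%:num)%:nng; rewrite /= EFinM.
  exact: good_p (all_good j).
have [W mW [DW pW]] := all_good j0.
have -> : \bigcap_j D j = X `&` (fun t => (A j0 t, U j0 t)) @^-1` W.
  rewrite -DX -DW; apply: eq_bigcapr => j _.
  by case: eqP => [->|].
rewrite (@pair_law _ _ _ _ (pA j0) (pU j0) _ _ X c)//.
  by rewrite (bigD1 j0)//= cE muleC pW.
move=> a b ma mb; rewrite -DX.
rewrite (IH _ (fun j => if j == j0 then pA j0 a * pU j0 b else p j)%E).
- rewrite (bigD1 j0)//= eqxx muleC -cE; congr (_ * _)%E.
  by apply: eq_bigr => j /negPf ->.
- move=> j jk; case: eqP => [jj0|_]; first by move: jk; rewrite jj0 ltnn.
  by apply: gD; rewrite ltnS ltnW.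
- move=> j kj; case: eqP => [->|/eqP jj0]; first by exists a, b.
  apply: rD; rewrite ltn_neqAle kj andbT eq_sym.
  by apply: contra jj0 => /eqP jk; apply/eqP/val_inj.
Qed.

Lemma independent_pairs (W : forall j, set (TA j * TU j)) :
  (forall j, measurable (W j)) ->
  P (\bigcap_j (fun t => (A j t, U j t)) @^-1` W j) =
  (\prod_j (pA j \x pU j) (W j))%E.
Proof.
move=> mW; apply: (independent_upto (k := N)).
  by move=> j _; exists (W j).
by move=> j; rewrite leqNgt ltn_ord.
Qed.

End Independence.

(** * Volumes and the cylinder *)

Section Volumes.
Variable R : realType.

Definition cube n (w : 'rV[R]_n) (e : R) : set 'rV[R]_n :=
  [set v | forall k, w 0 k <= v 0 k < w 0 k + e].

Lemma measurable_cube n (w : 'rV[R]_n) (e : R) :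
  measurable (cube w e : set (borel 'rV[R]_n)).
Proof.
rewrite (_ : cube w e = \bigcap_(k in [set: 'I_n])
      ((fun p : borel 'rV[R]_n => (p : 'rV[R]_n) 0 k) @^-1`
        `[w 0 k, w 0 k + e[%classic)).
  apply: fin_bigcap_measurable => // k _.
  by rewrite -[X in measurable X]setTI; apply: measurable_mx_coord.
apply/seteqP; split => [p pk k _|p pk k] /=; first by rewrite in_itv/=.
by have := pk k I; rewrite /= in_itv.
Qed.

Lemma lebesgue_rV_cube n (w : 'rV[R]_n) (e : R) : 0 <= e ->
  lebesgue_rV R n (cube w e) = (e ^+ n)%:E.
Proof.
move=> e0; elim: n w => [|n IH] w.
  rewrite /= /dirac indicE (_ : _ \in _ = true) ?expr0//.
  by apply/mem_set => -[].
pose w' : 'rV[R]_n := \row_k w 0 (lift ord0 k).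
rewrite [LHS]/= /lebesgue_rVS /pushforward.
rewrite (_ : _ @^-1` _ = `[w 0 0, w 0 0 + e[%classic `*` cube w' e).
  rewrite product_measure1E//; last exact: measurable_cube.
  have L : lebesgue_measure (`[w 0 0, w 0 0 + e[%classic : set R) = e%:E.
    rewrite lebesgue_measure_itv/= lte_fin ltrDl.
    have [e_gt0|] := ltP 0 e; first by rewrite -EFinD addrAC subrr add0r.
    by move=> e_le0; have -> : e = 0 by apply/eqP; rewrite eq_le e_le0.
  by rewrite [X in (X * _)%E]L [X in (_ * X)%E]IH exprS EFinM.
have c0 (x : R) (v : 'rV[R]_n) : (rVcons (x, v) : 'rV[R]_n.+1) 0 0 = x.
  rewrite /rVcons (ord0_lshift n).
  by rewrite [LHS](@row_mxEl _ 1 1 n) mxE eqxx.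
have cS (x : R) (v : 'rV[R]_n) k : (rVcons (x, v) : 'rV[R]_n.+1) 0 (lift ord0 k) = v 0 k.
  rewrite /rVcons lift0_rshift.
  by rewrite [LHS](@row_mxEr _ 1 1 n).
apply/seteqP; split => [[x v] /= H|[x v] /= [xw vw] k].
  split; first by have := H 0; rewrite c0 in_itv.
  by move=> k; have := H (lift ord0 k); rewrite cS mxE.
case: (unliftP ord0 k) => [l ->|->]; last by rewrite c0; move: xw; rewrite in_itv.
by rewrite cS; have := vw l; rewrite mxE.
Qed.

Lemma unit_ball_open n : open (@unit_ball R n).
Proof.
have sqc (s : seq 'I_n) : continuous (fun w : 'rV[R]_n => \sum_(k <- s) w 0 k ^+ 2).
  elim: s => [|k s IH].
    by under eq_fun do rewrite big_nil; exact: cst_continuous.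
  have -> : (fun w : 'rV[R]_n => \sum_(l <- k :: s) w 0 l ^+ 2) =
      ((fun w : 'rV[R]_n => w 0 k) \* (fun w : 'rV[R]_n => w 0 k)) \+
      (fun w : 'rV[R]_n => \sum_(l <- s) w 0 l ^+ 2).
    by apply/funext => w; rewrite big_cons expr2.
  move=> w; apply: continuousD; last exact: IH.
  by apply: continuousM; exact: coord_continuous.
rewrite (_ : @unit_ball R n = (fun w : 'rV[R]_n => \sum_k w 0 k ^+ 2) @^-1` `]-oo, 1[).
  by apply: open_comp; [move=> w _; exact: sqc|exact: interval_open].
by apply/seteqP; split => w; rewrite /unit_ball/= in_itv.
Qed.

Lemma measurable_unit_ball n : measurable (@unit_ball R n : set (borel 'rV[R]_n)).
Proof. by apply: sub_sigma_algebra; exact: unit_ball_open. Qed.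

Lemma unit_ball_coord n (w : 'rV[R]_n) k : unit_ball w -> `|w 0 k| < 1.
Proof.
move=> w1; rewrite -(@expr_lt1 _ 2)// real_normK ?num_real//.
apply: le_lt_trans w1; rewrite (bigD1 k)//= lerDl sumr_ge0// => l _.
exact: sqr_ge0.
Qed.

Lemma unit_ball_lty n : (lebesgue_rV R n (@unit_ball R n) < +oo)%E.
Proof.
apply: (@le_lt_trans _ _ (lebesgue_rV R n (cube (const_mx (-1)) 2))).
  apply: le_measure; rewrite ?inE; [exact: measurable_unit_ball|exact: measurable_cube|].
  move=> w wB k; have := unit_ball_coord k wB.
  by rewrite mxE ltr_norml; lra.
by rewrite lebesgue_rV_cube// ltry.
Qed.

Lemma ball_volume_gt0 n : 0 < ball_volume R n.
Proof.
(* In the cube of side e <= 1 at the origin, the sum of the n squares is at most n e < 1. *)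
pose e : R := n.+1%:R^-1.
have e0 : 0 < e by rewrite invr_gt0 ltr0n.
rewrite /ball_volume fine_gt0// unit_ball_lty andbT.
apply: (@lt_le_trans _ _ (lebesgue_rV R n (cube 0 e))).
  by rewrite lebesgue_rV_cube ?ltW// lte_fin exprn_gt0.
apply: le_measure; rewrite ?inE; [exact: measurable_cube|exact: measurable_unit_ball|].
move=> w we; apply: (@le_lt_trans _ _ (\sum_(k < n) e)).
  apply: ler_sum => k _; have := we k; rewrite mxE add0r => /andP[w0 we'].
  have e1 : e <= 1 by rewrite invf_le1 ?ltr0n// ler1n.
  by nra.
by rewrite sumr_const card_ord -mulr_natl ltr_pdivrMr ?ltr0n// mul1r ltr_nat.
Qed.

Lemma rVuncons_continuous n : continuous (fun p : 'rV[R]_n.+1 =>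
  (p 0 0, rsubmx (p : 'rV[R]_(1 + n))) : R * 'rV[R]_n).
Proof.
move=> p A [[B C] /= [nB nC] BCA].
have H1 : nbhs p [set q : 'rV[R]_n.+1 | B (q 0 0)].
  exact: (@coord_continuous R 1 n.+1 0 0 p B nB).
have H2 : nbhs p [set q : 'rV[R]_n.+1 | C (rsubmx (q : 'rV[R]_(1 + n)))].
  move/nbhs_ballP : nC => [e /= e0 eC]; apply/nbhs_ballP; exists e => //= y [_ xy].
  by apply: eC; split => // i j; rewrite !mxE; exact: xy.
by apply: filterS2 H1 H2 => q Bq Cq; apply: BCA.
Qed.

(** The product topology and the product sigma-algebra are related through row vectors of length
    n.+1: U is pulled back to an open set there by the continuous [rVuncons], then back again by the
    measurable [rVcons]. *)
Lemma open_prod_measurable n (U : set (R * 'rV[R]_n)) : open U ->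
  measurable (U : set (measurableTypeR R * borel 'rV[R]_n)).
Proof.
move=> oU; rewrite (_ : U = @rVcons R n @^-1` (@rVuncons R n @^-1` U)); last first.
  by apply/seteqP; split => p /=; rewrite rVconsK.
rewrite -[X in measurable X]setTI; apply: measurable_rVcons => //.
apply: sub_sigma_algebra.
by apply: (open_comp (f := fun p : 'rV[R]_n.+1 =>
  (p 0 0, rsubmx (p : 'rV[R]_(1 + n))) : R * 'rV[R]_n) _ oU) => p _;
  exact: rVuncons_continuous.
Qed.

Lemma cylinder_open n : open (@cylinder R n : set (R * 'rV[R]_n)).
Proof.
have -> : @cylinder R n = ([set p : R * 'rV[R]_n | (`]0, +oo[%classic : set R) p.1]) `&`
    [set p : R * 'rV[R]_n | @unit_ball R n p.2].
  by apply/seteqP; split => p; rewrite /cylinder/= in_itv/= andbT.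
apply: openI.
  apply: (@open_comp _ _ (fst : R * 'rV[R]_n -> R)).
    by move=> p _; exact: cvg_fst.
  exact: interval_open.
apply: (@open_comp _ _ (snd : R * 'rV[R]_n -> 'rV[R]_n)).
  by move=> p _; exact: cvg_snd.
exact: unit_ball_open.
Qed.

Lemma measurable_cylinder n : measurable (@cylinder R n).
Proof. exact: open_prod_measurable (@cylinder_open n). Qed.

Lemma continuous_cylinder_measurable n (f : R * 'rV[R]_n -> R) :
  {within (@cylinder R n : set (R * 'rV[R]_n)), continuous f} ->
  measurable_fun (@cylinder R n) f.
Proof.
move=> cf.
apply: (measurability _ (measurable_realfun.RGenOpens.measurableE R)).
move=> _ [_ [a [b ->]] <-]; apply: open_prod_measurable.
have oI := @interval_open R (BRight a) (BLeft b) isT isT.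
have /continuousP/(_ _ oI) := cf.
by rewrite -open_setSI//; exact: cylinder_open.
Qed.

End Volumes.

(** * The first point of the generic configuration *)

Section VoidSets.
Variables (R : realType) (n : nat).

(** Closed at x, to be complementary to the strict inequality in [beyond x]. *)
Definition slab (x : R) : set (borel 'rV[R]_n.+1) :=
  [set p | cylinder (rVuncons p) /\ (p : 'rV[R]_n.+1) 0 0 <= x].

Lemma measurable_cylinder_points :
  measurable ([set p | cylinder (rVuncons p)] : set (borel 'rV[R]_n.+1)).
Proof.
rewrite -[X in measurable X]setTI; apply: measurable_rVuncons => //.
exact: measurable_cylinder.
Qed.

Lemma measurable_slab x : measurable (slab x).
Proof.
apply: measurableI; first exact: measurable_cylinder_points.
have -> : (fun p : borel 'rV[R]_n.+1 => ((p : 'rV[R]_n.+1) 0 0 <= x) : Prop) =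
    (fun p : borel 'rV[R]_n.+1 => (p : 'rV[R]_n.+1) 0 0) @^-1` `]-oo, x]%classic.
  by apply/seteqP; split => p /=; rewrite in_itv.
by rewrite -[X in measurable X]setTI; exact: measurable_mx_coord.
Qed.

Section Class.
Variable g : grid_class R n.+1.
Notation torus := 'M[circle R]_(rk g, n.+1).

Definition scaled_point (i : 'I_(rk g)) m
    (z : borel 'M[R]_n.+1 * borel torus) : borel 'rV[R]_n.+1 :=
  gscale i *: (grid_point i m z : 'rV[R]_n.+1).

Lemma measurable_scaled_point i m : measurable_fun setT (scaled_point i m).
Proof.
apply: measurable_fun_mx => j k.
rewrite (_ : (fun _ => _) = fun z =>
    gscale i * (grid_point i m z : 'rV[R]_n.+1) j k); last first.
  by apply/funext => z; rewrite mxE.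
apply: measurable_funM => //.
exact: (measurableT_comp (@measurable_mx_coord R 1 n.+1 j k) (measurable_grid_point i m)).
Qed.

Definition void_set (x : R) : set (borel 'M[R]_n.+1 * borel torus) :=
  [set z | forall i m, ~ slab x (scaled_point i m z)].

Lemma measurable_void_set x : measurable (void_set x).
Proof.
rewrite (_ : void_set x = \bigcap_(i in [set: 'I_(rk g)])
    ~` \bigcup_(m in [set: 'rV[int]_n.+1]) (scaled_point i m @^-1` slab x)).
  apply: fin_bigcap_measurable => // i _; apply: measurableC.
  apply: countable_bigcupT_measurable => // m.
  rewrite -[X in measurable X]setTI; apply: measurable_scaled_point => //.
  exact: measurable_slab.
apply/seteqP; split => [z Hz i _ [m _]|z Hz i m Sm]; first exact: Hz.
by apply: (Hz i I); exists m.
Qed.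

End Class.
End VoidSets.
Arguments void_set {R n} g x.

Section GenericPoints.
Variables (R : realType) (n : nat) (pr : presentation R n.+1).
Context (dT : measure_display) (T : measurableType dT) (P : probability T R)
  (A : forall j : 'I_(nclasses pr), {RV P >-> borel 'M[R]_n.+1})
  (U : forall j : 'I_(nclasses pr),
    {RV P >-> borel 'M[circle R]_(rk (cls j), n.+1)}).

Let Y t := generic_points (fun j => A j t) (fun j => U j t).

Definition pt (psi : Psi pr) m t : borel 'rV[R]_n.+1 :=
  scaled_point (tagged psi) m (A (tag psi) t, U (tag psi) t).

Lemma generic_pointsE t y : Y t y <-> exists m, y.1 = pt y.2 m t.
Proof.
rewrite /Y /generic_points/=; split=> [[v [/torus_pi_row[m ->] ->]]|[m ->]].
  by exists m.
exists (map_mx intr m + row (tagged y.2) (torus_sec (U (tag y.2) t))); split => //.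
by apply/torus_pi_row; exists m.
Qed.

Lemma measurable_AU j : measurable_fun setT (fun t => (A j t, U j t)).
Proof. exact: measurable_fun_pair. Qed.

Lemma measurable_pt psi m : measurable_fun setT (pt psi m).
Proof.
exact: (measurableT_comp (measurable_scaled_point (tagged psi) m)
  (@measurable_AU (tag psi))).
Qed.

Definition void_event (x : R) : set T :=
  [set t | forall y, Y t y -> ~ slab x y.1].

Lemma void_eventE x :
  void_event x = \bigcap_j (fun t => (A j t, U j t)) @^-1` void_set (cls j) x.
Proof.
apply/seteqP; split => [t H j _ i m|t H [p psi] /generic_pointsE[m /= ->]].
  pose psi : Psi pr := Tagged _ i.
  have := H (pt psi m t, psi); apply.
  by apply/generic_pointsE; exists m.
by apply: (H (tag psi) I (tagged psi) m).
Qed.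

Lemma measurable_void_event x : measurable (void_event x).
Proof.
rewrite void_eventE; apply: fin_bigcap_measurable => // j _.
rewrite -[X in measurable X]setTI; apply: measurable_AU => //.
exact: measurable_void_set.
Qed.

Definition first_event (psi : Psi pr)
    (B : set (measurableTypeR R * borel 'rV[R]_n)) : set T :=
  [set t | exists y, [/\ first_point (Y t) y, y.2 = psi &
                      B (iota_refl (rVuncons y.1))]].

Lemma measurable_iota_refl : measurable_fun setT (@iota_refl R n).
Proof.
apply/measurable_fun_pairP; split; first exact: measurable_fst.
apply: measurable_fun_mx => i k.
rewrite (_ : (fun _ => _) = fun z : measurableTypeR R * borel 'rV[R]_n =>
   - ((z.2 : 'rV[R]_n) i k)); last by apply/funext => z; rewrite mxE.
apply: measurable_funN.
exact: (measurableT_comp (@measurable_mx_coord R 1 n i k) measurable_snd).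
Qed.

(** Indexing the candidate and its competitors by integer vectors leaves only countable operations:
    every competitor is outside the cylinder, or is the candidate with the same mark, or comes
    strictly later. *)
Lemma first_eventE psi B : first_event psi B =
  \bigcup_(m in [set: 'rV[int]_n.+1])
    ((pt psi m @^-1` [set p | cylinder (rVuncons p) /\ B (iota_refl (rVuncons p))]) `&`
     \bigcap_(psi' in [set: Psi pr]) \bigcap_(m' in [set: 'rV[int]_n.+1])
       ((pt psi' m' @^-1` ~` [set p | cylinder (rVuncons p)]) `|`
        ([set t | pt psi' m' t = pt psi m t] `&` [set t | psi' = psi]) `|`
        [set t | (pt psi m t : 'rV[R]_n.+1) 0 0 < (pt psi' m' t : 'rV[R]_n.+1) 0 0])).
Proof.
apply/seteqP; split=> [t [[p q] [[Yy Cy Hy] /= qpsi By]]|t [m _ [[Cm Bm] Hm]]].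
  subst q; have /generic_pointsE[m /= pm] := Yy.
  exists m => //; split; first by rewrite /= -pm; split.
  move=> psi' _ m' _; have [Cm'|nCm'] := pselect (cylinder (rVuncons (pt psi' m' t))).
    have [e|ne] := pselect ((pt psi' m' t, psi') = (p, psi)).
      by left; right; case: e => e1 e2; split => //=; rewrite -pm.
    right => /=; rewrite -pm; apply: (Hy (pt psi' m' t, psi')) => //.
    by apply/generic_pointsE; exists m'.
  by left; left.
exists (pt psi m t, psi); split => //; split => //.
  by apply/generic_pointsE; exists m.
move=> [p' psi'] /generic_pointsE[m' /= ->] Cm' ne.
have [[//|[/= e1 e2]]|//] := Hm psi' I m' I.
by exfalso; apply: ne; rewrite e1 e2.
Qed.

Lemma measurable_first_event psi B : measurable B -> measurable (first_event psi B).
Proof.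
move=> mB; rewrite first_eventE; apply: countable_bigcupT_measurable => // m.
apply: measurableI.
  rewrite -[X in measurable X]setTI; apply: measurable_pt => //.
  apply: measurableI; first exact: measurable_cylinder_points.
  have H := measurableT_comp measurable_iota_refl (@measurable_rVuncons R n).
  by have := H measurableT B mB; rewrite setTI.
have mc psi' m' k : measurable_fun setT (fun t => (pt psi' m' t : 'rV[R]_n.+1) 0 k).
  exact: (measurableT_comp (@measurable_mx_coord R 1 n.+1 0 k) (measurable_pt psi' m')).
apply: fin_bigcap_measurable; first exact: finite_finset.
move=> psi' _; rewrite -[X in measurable X]setCK setC_bigcap; apply: measurableC.
apply: countable_bigcupT_measurable => // m'; apply: measurableC.
apply: measurableU; first apply: measurableU.
- rewrite -[X in measurable X]setTI; apply: measurable_pt => //.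
  by apply: measurableC; exact: measurable_cylinder_points.
- have [e|ne] := pselect (psi' = psi); last first.
    rewrite (_ : _ `&` _ = set0); first exact: measurable0.
    by apply/seteqP; split => // t [].
  rewrite (_ : _ `&` _ = \bigcap_(k in [set: 'I_n.+1])
      (fun t => (pt psi' m' t : 'rV[R]_n.+1) 0 k - (pt psi m t : 'rV[R]_n.+1) 0 k)
        @^-1` [set 0]).
    apply: fin_bigcap_measurable => // k _; rewrite -[X in measurable X]setTI.
    by apply: measurable_funB => //; exact: mc.
  apply/seteqP; split => [t [/= eqt _] k _ /=|t H]; first by rewrite eqt subrr.
  split => //=; apply/rowP => k; have /= /eqP := H k I.
  by rewrite subr_eq0 => /eqP.
- rewrite (_ : [set t | _] = (fun t =>
     (pt psi' m' t : 'rV[R]_n.+1) 0 0 - (pt psi m t : 'rV[R]_n.+1) 0 0)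
        @^-1` `]0, +oo[%classic).
    rewrite -[X in measurable X]setTI.
    by apply: measurable_funB => //; exact: mc.
  by apply/seteqP; split => t /=; rewrite in_itv/= andbT subr_gt0.
Qed.

Lemma first_point_unique t y y' :
  first_point (Y t) y -> first_point (Y t) y' -> y = y'.
Proof.
move=> [Yy Cy Hy] [Yy' Cy' Hy']; apply: contrapT => ne.
have := lt_trans (Hy _ Yy' Cy' (nesym ne)) (Hy' _ Yy Cy ne).
by rewrite ltxx.
Qed.

Definition beyond (x : R) : set (measurableTypeR R * borel 'rV[R]_n) :=
  [set p | x < p.1].

Lemma measurable_beyond x : measurable (beyond x).
Proof.
rewrite (_ : beyond x = `]x, +oo[%classic `*` setT); first exact: measurableX.
by apply/seteqP; split => p; rewrite /beyond/= in_itv/= andbT// => -[].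
Qed.

Hypothesis first_exists : {ae P, forall t, exists y, first_point (Y t) y}.

(** Wherever a first point exists, hence almost surely, the slab up to x is empty exactly when that
    point lies beyond x. Its uniqueness makes the events for different psi disjoint. *)
Lemma void_event_first (x : R) :
  P (void_event x) = (\sum_psi P (first_event psi (beyond x)))%E.
Proof.
have sub psi : first_event psi (beyond x) `<=` void_event x.
  move=> t [y [[Yy Cy Hy] _ xy]] y' Yy' [Cy' y'x].
  have [yy'|ne] := pselect (y' = y).
    by move: y'x; rewrite leNgt; move: xy; rewrite yy' /beyond/= => ->.
  by have := lt_trans xy (Hy _ Yy' Cy' ne); rewrite ltNge y'x.
have mF psi := measurable_first_event psi (measurable_beyond x).
have mUF : measurable (\bigcup_psi first_event psi (beyond x)).
  by apply: fin_bigcup_measurable => //; exact: finite_finset.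
have -> : (\sum_psi P (first_event psi (beyond x)) =
    P (\bigcup_psi first_event psi (beyond x)))%E.
  rewrite measure_fin_bigcup//; last 2 first.
  - exact: finite_finset.
  - apply/trivIsetP => psi psi' _ _ ne; apply/seteqP; split => // t.
    move=> [[y [Fy yp _]] [y' [Fy' yp' _]]]; move/eqP: ne; apply.
    by rewrite -yp -yp' (first_point_unique Fy Fy').
  rewrite [LHS]fsbig_seq ?index_enum_uniq//; apply: eq_fsbigl.
  by apply/seteqP; split => // psi _ /=; rewrite mem_index_enum.
have [N [mN N0 HN]] := first_exists.
apply/eqP; rewrite eq_le; apply/andP; split.
  apply: (@le_trans _ _ (P (\bigcup_psi first_event psi (beyond x) `|` N))).
    apply: le_measure; rewrite ?inE; [exact: measurable_void_event|exact: measurableU|].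
    move=> t Vt; have [Nt|nNt] := pselect (N t); [by right|left].
    have [y Fy] : exists y, first_point (Y t) y.
      by apply: contrapT => ny; apply: nNt; apply: HN.
    exists y.2 => //.
    exists y; split => //; rewrite /beyond/= ltNge; apply/negP => yx.
    by have [Yy Cy _] := Fy; apply: (Vt y Yy).
  by apply: (le_trans (measureU2 _ mUF mN)); rewrite [X in (_ + X)%E]N0 adde0.
apply: le_measure; rewrite ?inE//; first exact: measurable_void_event.
by move=> t [psi _]; exact: sub.
Qed.

End GenericPoints.

(** * The transition kernel is bounded *)

Section KernelBound.
Variables (R : realType) (n : nat).
Hypothesis n_gt0 : (0 < n)%N.
Variables (mu : {measure set (borel 'M[R]_n.+1) -> \bar R})
  (F : set (borel 'M[R]_n.+1)).
Hypotheses (mu_haar : SL_haar mu) (F_dom : SLZ_fundamental_domain F).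
Variable pr : presentation R n.+1.
Hypothesis scale_gt0 : forall psi : Psi pr, 0 < scale psi.
Variable omega : forall j : 'I_(nclasses pr),
  probability (borel 'M[circle R]_(rk (cls j), n.+1)) R.
Hypothesis omega_gen : forall j, generic_measure (omega j).

Lemma density_gt0 (psi : Psi pr) : 0 < density psi.
Proof. by rewrite /density invr_gt0 exprn_gt0. Qed.

Lemma msr_gt0 (psi : Psi pr) : 0 < msr psi.
Proof.
rewrite /msr divr_gt0 ?density_gt0// /total_density (bigD1 psi)//=.
by rewrite ltr_pwDl ?density_gt0// sumr_ge0// => psi' _; rewrite ltW// density_gt0.
Qed.

Section Process.
Context (dT : measure_display) (T : measurableType dT) (P : probability T R)
  (A : forall j : 'I_(nclasses pr), {RV P >-> borel 'M[R]_n.+1})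
  (U : forall j : 'I_(nclasses pr),
    {RV P >-> borel 'M[circle R]_(rk (cls j), n.+1)}).
Hypothesis AU_indep : independent_families A U.
Hypothesis A_law : forall j B, measurable B -> distribution P (A j) B = mu (B `&` F).
Hypothesis U_law : forall j B, measurable B -> distribution P (U j) B = omega j B.

Let pA j : probability (borel 'M[R]_n.+1) R := distribution P (A j).

Lemma pairs_law (W : forall j,
    set (borel 'M[R]_n.+1 * borel 'M[circle R]_(rk (cls j), n.+1))) :
  (forall j, measurable (W j)) ->
  P (\bigcap_j (fun t => (A j t, U j t)) @^-1` W j) =
  (\prod_j (pA j \x omega j) (W j))%E.
Proof.
by apply: (@independent_pairs _ _ _ _ _ _ _ _ _ A U pA omega) => // j b; exact: U_law.
Qed.

Lemma void_probability x : P (void_event A U x) =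
  (\prod_j \int[mu]_(B in F) omega j (xsection (void_set (cls j) x) B))%E.
Proof.
rewrite void_eventE pairs_law; last by move=> j; exact: measurable_void_set.
apply: eq_bigr => j _; apply: (integral_domain F_dom (pA := pA j)).
- by move=> B; exact: A_law.
- by apply: measurable_fun_xsection; exact: measurable_void_set.
- by move=> B; exact: measure_ge0.
Qed.

(** A first point marked psi belongs to the grid of psi, so this grid, before scaling, hits S'. The
    other classes are left unconstrained and contribute factors 1. *)
Lemma first_event_le psi (S : set (measurableTypeR R * borel 'rV[R]_n))
    (S' : set (borel 'rV[R]_n.+1)) :
  measurable S -> measurable S' ->
  (forall p, S (iota_refl (rVuncons (scale psi *: p))) -> S' p) ->
  (P (first_event A U psi S) <=
    (pA (tag psi) \x omega (tag psi)) (hit_set (tagged psi) S'))%E.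
Proof.
move=> mS mS' SS'.
(* The quantification over [i] avoids transporting [hit_set] from [tag psi] to [j]. *)
pose W j : set (borel 'M[R]_n.+1 * borel 'M[circle R]_(rk (cls j), n.+1)) :=
  [set z | forall i, Tagged (fun j => 'I_(rk (cls j))) i = psi -> hit_set i S' z].
have Wpsi : W (tag psi) = hit_set (tagged psi) S'.
  apply/seteqP; split => [z Hz|z Hz i].
    by apply: Hz; case: (psi).
  move=> e; suff -> : i = tagged psi by [].
  by apply/eqP; rewrite eq_sym -eq_Tagged e.
have Wne j : j != tag psi -> W j = setT.
  move=> jpsi; apply/seteqP; split => // z _ i e.
  by move: jpsi; rewrite -e eqxx.
have mW j : measurable (W j).
  have [->|/Wne ->//] := eqVneq j (tag psi).
  by rewrite Wpsi; exact: measurable_hit_set.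
apply: (@le_trans _ _ (P (\bigcap_j (fun t => (A j t, U j t)) @^-1` W j))).
  apply: le_measure; rewrite ?inE.
  - exact: measurable_first_event.
  - apply: fin_bigcap_measurable => // j _; rewrite -[X in measurable X]setTI.
    exact: (@measurable_AU _ _ _ _ _ _ A U j).
  - move=> t [y [[/generic_pointsE[m ym] _ _] ypsi Sy]] j _ i ie.
    subst psi; rewrite /hit_set/=; apply/hitsE; exists m.
    apply: SS'; move: Sy; rewrite ym.
    by rewrite -ie.
rewrite pairs_law// (bigD1 (tag psi))//= Wpsi big1 ?mule1// => j jpsi.
rewrite Wne// -setXTT product_measure1E//.
by rewrite [X in (X * _)%E]probability_setT [X in (_ * X)%E]probability_setT mule1.
Qed.

End Process.
Variable k : R -> 'rV[R]_n -> Psi pr -> R.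
Hypothesis k_pr : transition_kernel mu F omega k.

(** If k were larger somewhere, then by continuity it would exceed some M' > K' / kap on a small
    box, say of side h. The first point would fall there with probability at least kap M' h^(n+1),
    against the upper bound K' h^(n+1). *)
Lemma kernel_le psi : exists2 M : R, 0 <= M &
  forall x w, 0 < x -> unit_ball w -> k x w psi <= M.
Proof.
have [K K0 HK] := @hit_probability_box R n n_gt0.
have [k0 kc [dT [T [P [A [U [AU_indep A_law U_law _ dens]]]]]]] := k_pr.
pose kap := msr psi / ball_volume R n.
have kap0 : 0 < kap by rewrite divr_gt0 ?msr_gt0 ?ball_volume_gt0.
pose c := scale psi.
have c0 : 0 < c by exact: scale_gt0.
(* Dividing by the scale c shrinks all sides of the box by c; the 2 is the doubling of the cube made
   below to allow for the reflection. *)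
pose K' := K * c^-1 * (2 / c) ^+ n.
have K'0 : 0 < K' by rewrite !mulr_gt0 ?exprn_gt0 ?divr_gt0// invr_gt0.
exists (K' / kap); first by rewrite divr_ge0 ?ltW.
move=> x w x0 wB; rewrite leNgt; apply/negP => kM.
pose M' := (K' / kap + k x w psi) / 2.
have M'K : K' / kap < M' by rewrite /M'; lra.
have M'k : M' < k x w psi by rewrite /M'; lra.
have M'0 : 0 < M' by apply: lt_trans M'K; rewrite divr_gt0.
have ck : {for (x, w), continuous (fun p : R * 'rV[R]_n => k p.1 p.2 psi)}.
  have := kc psi; rewrite continuous_open_subspace; last exact: cylinder_open.
  by apply; rewrite inE.
have nb : nbhs (x, w) (@cylinder R n `&` [set p | M' < k p.1 p.2 psi]).
  apply: filterI; last exact: (cvgr_gt _ ck).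
  by apply: open_nbhs_nbhs; split => //; exact: cylinder_open.
have [e e0 He] : exists2 e : R, 0 < e &
    forall y v, x <= y < x + e -> cube w e v ->
      cylinder (y, v) /\ M' < k y v psi.
  case: nb => -[N1 N2] /= [/nbhs_ballP[e1 /= e10 He1] /nbhs_ballP[e2 /= e20 He2]] N12.
  exists (Num.min e1 e2); first by rewrite lt_min e10.
  move=> y v yx vw; apply: (N12 (y, v)); split => /=.
    apply: He1; rewrite /ball/= distrC ger0_norm; last by lra.
    by case/andP: yx => _; rewrite -ltrBlDl lt_min => /andP[].
  apply: He2; split => // i j; rewrite /ball/= ord1 distrC ger0_norm.
    by have /andP[_] := vw j; rewrite -ltrBlDl lt_min => /andP[].
  by have /andP[] := vw j; rewrite subr_ge0.
(* The bound h <= x becomes, after scaling, the hypothesis h <= a of the estimate for boxes. *)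
pose h := Num.min e x.
have h0 : 0 < h by rewrite lt_min e0.
have [he hx] : h <= e /\ h <= x by rewrite !ge_min !lexx orbT.
pose S : set (measurableTypeR R * borel 'rV[R]_n) := `[x, x + h[%classic `*` cube w h.
have mS : measurable S.
  by apply: measurableX; [exact: measurable_itv|exact: measurable_cube].
have SP p : S p -> cylinder p /\ M' < k p.1 p.2 psi.
  move=> [/= p1 p2]; case: p p1 p2 => y v /= yx vw; apply: He.
    by move: yx; rewrite in_itv/=; lra.
  by move=> j; have := vw j; lra.
have Svol : (lebesgue_measure \x lebesgue_rV R n)%E S = (h * h ^+ n)%:E.
  rewrite product_measure1E//; last exact: measurable_cube.
  rewrite [X in (_ * X)%E]lebesgue_rV_cube ?ltW//.
  have L : lebesgue_measure (`[x, x + h[%classic : set R) = h%:E.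
    by rewrite lebesgue_measure_itv/= lte_fin ltrDl h0 -EFinD addrAC subrr add0r.
  by rewrite [X in (X * _)%E]L -EFinM.
have := dens psi S mS.
have -> : S `&` @cylinder R n = S by apply/setIidl => p /SP[].
move=> densS.
(* [iota_refl] reverses the half-open sides of the cube, hence the factor 2. *)
pose b : set (borel 'rV[R]_n.+1) :=
  box (x / c) (h / c) (- c^-1 *: w - const_mx (h / c)) (2 * (h / c)).
have up : (P (first_event A U psi S) <= (K * (h / c) * (2 * (h / c)) ^+ n)%:E)%E.
  have mb : measurable b by exact: measurable_box.
  apply: (le_trans (first_event_le AU_indep U_law mS mb _)).
    move=> p; rewrite /iota_refl/rVuncons /= => -[/=].
    rewrite in_itv/= mxE => p0 pw.
    split; first by rewrite ler_pdivrMr// -mulrDl ltr_pdivlMr// mulrC.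
    move=> j; have := pw j; rewrite !mxE -(lift0_rshift j) -/c => /andP[h1 h2].
    have -> : - c^-1 * w 0 j - h / c = (- w 0 j - h) / c by ring.
    have -> : (- w 0 j - h) / c + 2 * (h / c) = (- w 0 j + h) / c by ring.
    rewrite ler_pdivrMr// ltr_pdivlMr// mulrC; apply/andP; split; lra.
  apply: (HK mu F) => //.
  - by move=> B mB; exact: A_law.
  - by rewrite divr_gt0.
  - by rewrite ler_pM2r ?invr_gt0.
  - by rewrite mulr_gt0// divr_gt0.
have lo : ((kap * (M' * (h * h ^+ n)))%:E <= P (first_event A U psi S))%E.
  rewrite [leRHS]densS EFinM lee_pmul2l ?lte_fin ?fin_num_abs//; last by rewrite ltry.
  rewrite EFinM -Svol -integral_cst//; apply: ge0_le_integral => //.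
  - by move=> p _; rewrite lee_fin ltW.
  - apply/measurable_EFinP; apply: measurable_funS (continuous_cylinder_measurable (kc psi)) => //.
      exact: measurable_cylinder.
    by move=> p /SP[].
  - by move=> p /SP[_ pM]; rewrite lee_fin ltW.
have := le_trans lo up; rewrite lee_fin.
have -> : K * (h / c) * (2 * (h / c)) ^+ n = K' * (h * h ^+ n).
  by rewrite /K' !exprMn; ring.
rewrite mulrA ler_pM2r; last by rewrite mulr_gt0// exprn_gt0.
by rewrite leNgt -ltr_pdivrMl// mulrC M'K.
Qed.

End KernelBound.

(** * Tail and continuity of the free path length density *)

Section FreePathTail.
Variables (R : realType) (n : nat).
Hypothesis n_gt0 : (0 < n)%N.
Variables (mu : {measure set (borel 'M[R]_n.+1) -> \bar R})
  (F : set (borel 'M[R]_n.+1)).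
Hypotheses (mu_haar : SL_haar mu) (F_dom : SLZ_fundamental_domain F).
Variable pr : presentation R n.+1.
Hypothesis scale_gt0 : forall psi : Psi pr, 0 < scale psi.
Variable omega : forall j : 'I_(nclasses pr),
  probability (borel 'M[circle R]_(rk (cls j), n.+1)) R.
Hypothesis omega_gen : forall j, generic_measure (omega j).
Variable k : R -> 'rV[R]_n -> Psi pr -> R.
Hypothesis k_pr : transition_kernel mu F omega k.

Let lam := lebesgue_rV R n.
Let B1 : set (borel 'rV[R]_n) := @unit_ball R n.
Let wint psi x : R := \int[lam]_(w in B1) k x w psi.

Let mB1 : measurable B1. Proof. exact: measurable_unit_ball. Qed.

Let mk psi : measurable_fun (@cylinder R n)
  (fun p : measurableTypeR R * borel 'rV[R]_n => k p.1 p.2 psi).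
Proof. have [_ kc _] := k_pr; exact: continuous_cylinder_measurable (kc psi). Qed.

Let mk1 psi (x : R) : 0 < x -> measurable_fun B1 (fun w => k x w psi).
Proof.
move=> x0.
have mx : measurable_fun B1 (fun w : borel 'rV[R]_n => (x : measurableTypeR R, w)).
  by apply: measurable_funTS; apply: measurable_fun_pair.
apply: (measurable_comp (@measurable_cylinder R n) _ (mk psi) mx).
by move=> _ [w wB <-]; split.
Qed.

Let k_integrable psi (x : R) : 0 < x -> lam.-integrable B1 (EFin \o (fun w => k x w psi)).
Proof.
move=> x0.
have [M M0 HM] := kernel_le n_gt0 mu_haar F_dom scale_gt0 omega_gen k_pr psi.
have [k0 _ _] := k_pr.
apply: measurable_bounded_integrable => //.
- exact: unit_ball_lty.
- exact: mk1.
- exists M; split; first exact: num_real.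
  move=> y My w wB; rewrite /= ger0_norm ?k0//.
  by rewrite (le_trans (HM _ _ x0 wB))// ltW.
Qed.

Let wintE psi (x : R) : 0 < x -> (wint psi x)%:E = (\int[lam]_(w in B1) (k x w psi)%:E)%E.
Proof.
move=> x0; rewrite /wint /Rintegral fineK//.
exact: (integrable_fin_num mB1 (k_integrable psi x0)).
Qed.

Let wint_ge0 psi (x : R) : 0 < x -> 0 <= wint psi x.
Proof.
move=> x0; have [k0 _ _] := k_pr.
by rewrite -lee_fin wintE//; apply: integral_ge0 => w wB; rewrite lee_fin k0.
Qed.

Lemma free_path_densityE x : free_path_density k x =
  \sum_psi msr psi / ball_volume R n * wint psi x.
Proof.
by rewrite /free_path_density mulr_sumr; apply: eq_bigr => psi _; rewrite /wint; ring.
Qed.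

(** Tonelli for the kernel extended by 0: the inner integral is [wint psi y] for y > x and 0
    otherwise. The restriction x >= 0 keeps y positive, where k is nonnegative and measurable. *)
Let tail_psi psi (x : R) : 0 <= x ->
  measurable_fun `]x, +oo[%classic (fun y : measurableTypeR R => (wint psi y)%:E) /\
  (\int[lebesgue_measure \x lam]_(p in @beyond R n x `&` @cylinder R n)
      (k p.1 p.2 psi)%:E =
   \int[lebesgue_measure]_(y in `]x, +oo[) (wint psi y)%:E)%E.
Proof.
move=> x0; have [k0 _ _] := k_pr.
pose D : set (measurableTypeR R * borel 'rV[R]_n) := @beyond R n x `&` @cylinder R n.
have mD : measurable D.
  by apply: measurableI; [exact: measurable_beyond|exact: measurable_cylinder].
pose f : measurableTypeR R * borel 'rV[R]_n -> \bar R :=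
  (fun p => (k p.1 p.2 psi)%:E) \_ D.
have mf : measurable_fun setT f.
  apply/(measurable_restrictT _ _).1 => //; apply/measurable_EFinP.
  by apply: measurable_funS (mk psi); [exact: measurable_cylinder|exact: subIsetr].
have f0 z : (0 <= f z)%E.
  rewrite /f patchE; case: ifPn => //; rewrite inE => -[_ [z1 z2]].
  by rewrite lee_fin k0.
have FE y : fubini_F lam f y = if x < y then (wint psi y)%:E else 0%E.
  rewrite /fubini_F; case: ifPn => [xy|nxy].
    have y0 : 0 < y by exact: le_lt_trans xy.
    rewrite wintE// [RHS]integral_mkcond; apply: eq_integral => w _.
    rewrite /f !patchE; congr (if _ then _ else _).
    apply/idP/idP; rewrite !inE; first by case=> _ [].
    by move=> wB; split.
  apply: integral0_eq => w _; rewrite /f patchE ifF//.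
  by apply/negbTE; apply: contra nxy; rewrite inE => -[].
have mF : measurable_fun setT (fubini_F lam f).
  exact: measurable_fun_fubini_tonelli_F.
split.
  apply: (eq_measurable_fun (fubini_F lam f)).
    by move=> y; rewrite inE/= in_itv/= andbT => xy; rewrite FE xy.
  exact: measurable_funTS mF.
rewrite integral_mkcond -/f fubini_tonelli1// [RHS]integral_mkcond.
apply: eq_integral => y _; rewrite FE patchE; congr (if _ then _ else _).
by apply/idP/idP; rewrite inE/= in_itv/= andbT.
Qed.

Lemma free_path_density_ge0 (x : R) : 0 < x -> 0 <= free_path_density k x.
Proof.
move=> x0; rewrite free_path_densityE; apply: sumr_ge0 => psi _.
by rewrite mulr_ge0 ?wint_ge0// divr_ge0// ltW// ?msr_gt0// ball_volume_gt0.
Qed.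

Lemma measurable_free_path_density (x : R) : 0 <= x ->
  measurable_fun `]x, +oo[%classic (fun y : measurableTypeR R => (free_path_density k y)%:E).
Proof.
move=> x0.
have -> : (fun y : measurableTypeR R => (free_path_density k y)%:E) =
    (fun y => \sum_psi ((msr psi / ball_volume R n)%:E * (wint psi y)%:E)%E).
  apply/funext => y; rewrite free_path_densityE -sumEFin.
  by apply: eq_bigr => psi _; rewrite EFinM.
apply: emeasurable_sum => psi.
by apply: measurable_funeM; have [] := tail_psi psi x0.
Qed.

(** Both sides are the void probability up to x, on the left through the law of the first point, on
    the right through independence. The right side no longer mentions the probability space hidden
    in the kernel. *)
Lemma free_path_tail (x : R) : 0 <= x ->
  (\int[lebesgue_measure]_(y in `]x, +oo[) (free_path_density k y)%:E =
   \prod_j \int[mu]_(B in F) omega j (xsection (void_set (cls j) x) B))%E.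
Proof.
move=> x0.
have [k0 kc [dT [T [P [A [U [AU_indep A_law U_law first_ex dens]]]]]]] := k_pr.
rewrite -(void_probability F_dom AU_indep A_law U_law) (void_event_first first_ex).
under eq_integral do rewrite free_path_densityE -sumEFin.
rewrite ge0_integral_sum//; last 2 first.
- move=> psi; rewrite (_ : (fun _ => _) = fun y =>
    ((msr psi / ball_volume R n)%:E * (wint psi y)%:E)%E); last first.
    by apply/funext => y; rewrite EFinM.
  by apply: measurable_funeM; have [] := tail_psi psi x0.
- move=> psi y; rewrite /= in_itv/= andbT => xy; rewrite lee_fin.
  rewrite mulr_ge0 ?wint_ge0 ?(le_lt_trans x0)// divr_ge0// ltW// ?msr_gt0//.
  exact: ball_volume_gt0.
apply: eq_bigr => psi _.
rewrite [RHS](dens psi _ (measurable_beyond x)) (tail_psi psi x0).2.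
under eq_integral do rewrite EFinM.
rewrite ge0_integralZl//.
- by have [] := tail_psi psi x0.
- move=> y; rewrite /= in_itv/= andbT => xy.
  by rewrite lee_fin wint_ge0// (le_lt_trans x0).
- by rewrite lee_fin divr_ge0// ltW// ?msr_gt0// ball_volume_gt0.
Qed.

Lemma free_path_density_continuous (x : R) : 0 < x ->
  {for x, continuous (free_path_density k)}.
Proof.
move=> x0.
have [k0 kc _] := k_pr.
have cI psi : {for x, continuous (wint psi)}.
  have [M M0 HM] := kernel_le n_gt0 mu_haar F_dom scale_gt0 omega_gen k_pr psi.
  (* The interval from x / 2 to 2 x is a neighbourhood of x on which y stays positive, so that the
     constant M dominates; it is integrable on the ball of finite volume. *)
  have := @continuity_under_integral R _ _ lam (fun y w => k y w psi) B1 mB1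
    (x / 2) (x * 2).
  move=> /(_ _ _ (cst M)).
  have I0 y : `]x / 2, x * 2[%classic y -> 0 < y.
    by rewrite /= in_itv/=; lra.
  apply.
  - by move=> y /I0 y0; exact: k_integrable.
  - apply: aeW => w wB y; rewrite inE => /I0 y0.
    have ck : {for (y, w), continuous (fun p : R * 'rV[R]_n => k p.1 p.2 psi)}.
      have := kc psi; rewrite continuous_open_subspace; last exact: cylinder_open.
      by apply; rewrite inE.
    move=> N /ck[[N1 N2] /= [nN1 nN2] N12]; apply: filterS nN1 => z N1z.
    by apply: (N12 (z, w)); split => //; exact: nbhs_singleton nN2.
  - apply: measurable_bounded_integrable => //; first exact: unit_ball_lty.
    exact: bounded_cst.
  - move=> y /I0 y0; apply: aeW => w wB.
    by rewrite ger0_norm ?k0// HM.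
  - by rewrite inE/= in_itv/=; lra.
rewrite (_ : free_path_density k =
    fun y => \sum_psi msr psi / ball_volume R n * wint psi y); last first.
  by apply/funext => y; exact: free_path_densityE.
elim: (index_enum _) => [|psi s IH].
  rewrite (_ : (fun y => \sum_(psi <- [::]) _) = cst 0); first exact: cst_continuous.
  by apply/funext => y; rewrite big_nil.
have -> : (fun y => \sum_(phi <- psi :: s) msr phi / ball_volume R n * wint phi y) =
    (fun y => msr psi / ball_volume R n * wint psi y) \+
    (fun y => \sum_(phi <- s) msr phi / ball_volume R n * wint phi y).
  by apply/funext => y; rewrite big_cons.
apply: continuousD; last exact: IH.
by apply: continuousM; [exact: cst_continuous|exact: cI].
Qed.

End FreePathTail.

(** Near x the tail is the fixed integral over ]a, +oo[ minus the integral over ]a, y], to which the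
    fundamental theorem of calculus applies. *)
Lemma is_derive_tail_integral (R : realType) (f : R -> R) (a x : R) : a < x ->
  lebesgue_measure.-integrable `]a, +oo[ (EFin \o f) -> {for x, continuous f} ->
  is_derive x 1 (fun y => \int[lebesgue_measure]_(t in `]y, +oo[) f t) (- f x).
Proof.
move=> ax intf cf.
have intf1 : lebesgue_measure.-integrable `]a, x + 1] (EFin \o f).
  apply: integrableS intf => //.
  by move=> y /=; rewrite !in_itv/= andbT => /andP[].
have xx1 : x < x + 1 by rewrite ltrDl.
have [dF F'] := @continuous_FTC1 R f (BRight a) x (x + 1) xx1 intf1 ax cf.
apply: (@near_eq_is_derive _ _ _ (fun y =>
  \int[lebesgue_measure]_(t in `]a, +oo[) f t -
  \int[lebesgue_measure]_(t in `]a, y]) f t)).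
  near=> y; apply: Rintegral_itvB => //.
  by rewrite bnd_simp ltW//; near: y; exact: lt_nbhsr.
rewrite -sub0r; apply: is_deriveB.
by apply: DeriveDef => //; rewrite -derive1E.
Unshelve. all: by end_near. Qed.

Theorem corollary1p4 (R : realType) (n : nat) (n_gt0 : (0 < n)%N)
  (P : set 'rV[R]_n.+1) (pr : presentation R n.+1)
  (P_pr : presents pr P) (pr_adm : admissible pr)
  (mu : {measure set (borel 'M[R]_n.+1) -> \bar R}) (F : set (borel 'M[R]_n.+1))
  (mu_haar : SL_haar mu) (F_dom : SLZ_fundamental_domain F) (mu_F : mu F = 1%E)
  (omega : forall j : 'I_(nclasses pr),
     probability (borel 'M[circle R]_(rk (cls j), n.+1)) R)
  (omega_gen : forall j, generic_measure (omega j))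
  (k : R -> 'rV[R]_n -> Psi pr -> R)
  (k_pr : transition_kernel mu F omega k)
  (kj : forall j : 'I_(nclasses pr),
     R -> 'rV[R]_n -> Psi (sub_presentation j) -> R)
  (kj_pr : forall j : 'I_(nclasses pr),
     @transition_kernel R n mu F (sub_presentation j) (fun=> omega j) (kj j)) :
  forall xi : R, 0 < xi ->
    is_derive xi 1
      (fun x : R => \prod_(j < nclasses pr)
         \int[@lebesgue_measure R]_(x' in `]x, +oo[) free_path_density (kj j) x')
      (- free_path_density k xi).
Proof.
have [[_ _ _ scale_gt0] _ _ _] := P_pr.
(* The void probability of class j. It appears both as a factor in the tail for [pr] and as the
   whole tail for [sub_presentation j]; being finite, it can be moved from extended to real
   products. *)
pose e j x : \bar R := (\int[mu]_(B in F) omega j (xsection (void_set (cls j) x) B))%E.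
have e_fin j x : e j x \is a fin_num.
  have [mF _ _] := F_dom.
  have e0 : (0 <= e j x)%E by apply: integral_ge0 => B _; exact: measure_ge0.
  rewrite ge0_fin_numE//; apply: (@le_lt_trans _ _ (\int[mu]_(B in F) 1)%E).
    apply: ge0_le_integral => //.
    - apply: measurable_funTS; apply: measurable_fun_xsection.
      exact: measurable_void_set.
    - move=> B _; apply: probability_le1; apply: measurable_xsection.
      exact: measurable_void_set.
  by rewrite integral_cst// mul1e mu_F ltry.
have sub_scale (j : 'I_(nclasses pr)) (psi : Psi (sub_presentation j)) : 0 < scale psi.
  exact: (scale_gt0 (existT (fun j => 'I_(rk (cls j))) j (tagged psi))).
have tailj j x : 0 <= x ->
    \int[lebesgue_measure]_(y in `]x, +oo[) free_path_density (kj j) y = fine (e j x).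
  move=> x0; rewrite /Rintegral; congr fine.
  rewrite (free_path_tail n_gt0 mu_haar F_dom (@sub_scale j) (fun=> omega_gen j) (kj_pr j) x0).
  by rewrite big_ord1.
have tail x : 0 <= x ->
    (\int[lebesgue_measure]_(y in `]x, +oo[) (free_path_density k y)%:E = \prod_j e j x)%E.
  by move=> x0; rewrite (free_path_tail n_gt0 mu_haar F_dom scale_gt0 omega_gen k_pr x0).
have prodE x : (\prod_j e j x = (\prod_j fine (e j x))%:E)%E.
  by rewrite -prodEFin; apply: eq_bigr => j _; rewrite fineK.
move=> xi xi0.
(* The tail formulas hold for x >= 0, so the product is identified with the tail of the density near
   xi, as the derivative requires. *)
apply: (@near_eq_is_derive R R R (fun x : R =>
  \int[lebesgue_measure]_(y in `]x, +oo[) free_path_density k y : R)).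
  near=> x; have x0 : 0 < x by near: x; exact: lt_nbhsr.
  rewrite [LHS]/Rintegral tail ?ltW// prodE /=; apply: eq_bigr => j _.
  by rewrite tailj// ltW.
(* Any base point strictly between 0 and xi would do; there the density is nonnegative and its
   integral is a finite product of void probabilities. *)
apply: (@is_derive_tail_integral _ _ (xi / 2)); first by lra.
  have x0 : 0 <= xi / 2 by lra.
  apply/integrableP; split.
    exact: (measurable_free_path_density n_gt0 mu_haar F_dom scale_gt0 omega_gen k_pr x0).
  under eq_integral => y.
    rewrite inE/= in_itv/= andbT => xy; rewrite ger0_norm; last first.
      apply: (free_path_density_ge0 n_gt0 mu_haar F_dom scale_gt0 omega_gen k_pr).
      exact: le_lt_trans xy.
    over.
  by rewrite tail// prodE ltry.
exact: (free_path_density_continuous n_gt0 mu_haar F_dom scale_gt0 omega_gen k_pr).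
Unshelve. all: by end_near. Qed.
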